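(* Let $D$ be a Dirichlet–Ferguson process with parameter $\alpha$ on $(A,\mathcal{A})$ and let $\mathbf{X}=\{X_n:n\ge1\}$ be the associated Pólya sequence with parameter $\alpha$. For every $N\ge1$, the space $\mathcal{M}_N(D)$ is generated (as a closed linear subspace of $L^2(D)$) by random variables of the type $$Y=L^2\text{-}\lim_{K\to+\infty}\frac{1}{\binom KN}\sum_{1\le j_1<\cdots<j_N\le K}h(X_{j_1},\ldots,X_{j_N}),\qquad h\in\Xi_N(\mathbf{X}).$$
   Context: $(A,\mathcal{A})$ is a Polish space with its Borel $\sigma$-field and $\alpha$ is a finite positive measure on it ($0<\alpha(A)<\infty$). On a probability space $(\Omega,\mathcal{F},\mathbb{P})$, the Pólya sequence $\mathbf{X}=\{X_n:n\ge1\}$ with parameter $\alpha$ is a sequence of $A$-valued random variables such that, for every $k\ge1$ and $1\le j_1<\cdots<j_k$, $$\mathbb{P}(X_{j_1}\in da_1,\ldots,X_{j_k}\in da_k)=\prod_{i=1}^k\frac{\alpha(da_i)+\sum_{l=1}^{i-1}\delta_{a_l}(da_i)}{\alpha(A)+i-1}.$$ Write $\mathbf{X}_n=(X_1,\ldots,X_n)$. A Dirichlet–Ferguson process with parameter $\alpha$ is a random probability measure $D$ on $(A,\mathcal{A})$ such that for every finite measurable partition $(C_1,\ldots,C_n)$ of $A$ the vector $(D(C_1),\ldots,D(C_n))$ has a Dirichlet distribution with parameters $(\alpha(C_1),\ldots,\alpha(C_n))$. Standing convention: $D$ is the a.s. limit of the empirical measures $\frac1n\sum_{i=1}^n\mathbf{1}_C(X_i)$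 of $\mathbf{X}$ (a.s. convergence for all $C\in\mathcal{A}$); then, conditionally on $D$, the $X_i$ are i.i.d. with law $D$. $L^2(D)$ is the Hilbert space of square-integrable random variables measurable with respect to $\sigma(D(C):C\in\mathcal{A})$; $D^{\otimes n}$ is the $n$-fold random product measure. $\Xi_n(\mathbf{X})$ is the class of symmetric measurable $h:A^n\to\mathbb{R}$ with $\mathbb{E}(h(\mathbf{X}_n)^2)<\infty$ and $\mathbb{E}(h(\mathbf{X}_n)\mid\mathbf{X}_{n-1})=0$ a.s. (for $n=1$: $\mathbb{E}(h(X_1))=0$). For $n\ge1$, $\mathcal{M}_n(D)=\{Y\in L^2(D):Y=\int_{A^n}h\,\mathrm{d}D^{\otimes n},\ h\in\Xi_n(\mathbf{X})\}$. *)

(* Defs.v *)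
From HB Require Import structures.
From mathcomp Require Import all_boot all_order perm all_algebra.
From mathcomp Require Import all_classical all_reals all_analysis.
From mathcomp Require Import measurable_realfun.

Set Implicit Arguments.
Unset Strict Implicit.
Unset Printing Implicit Defensive.
Import Order.TTheory GRing.Theory Num.Theory.
Import numFieldNormedType.Exports.

Local Open Scope classical_set_scope.
Local Open Scope ring_scope.

Definition is_distance (R : realType) (T : Type) (dist : T -> T -> R) : Prop :=
  [/\ forall x y, 0 <= dist x y,
      forall x y, dist x y = 0 <-> x = y,
      forall x y, dist x y = dist y x &
      forall x y z, dist x z <= dist x y + dist y z].

Definition polish (R : realType) (T : topologicalType) : Prop :=
  (exists2 S : set T, countable S & dense S) /\
  exists dist : T -> T -> R,
    [/\ is_distance dist,
        forall U : set T, open U <->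
          (forall x, U x -> exists2 e : R, 0 < e & [set y | dist x y < e] `<=` U) &
        forall u : nat -> T,
          (forall e : R, 0 < e -> exists n0 : nat, forall m n : nat,
             (n0 <= m)%N -> (n0 <= n)%N -> dist (u m) (u n) < e) ->
          exists l : T, u @ \oo --> l].

Notation borel A := (g_sigma_algebraType (@open A)).

Section tuple_product.
Context d (T : measurableType d) (R : realType).

Definition tuple_consp n (x : T * n.-tuple T) : n.+1.-tuple T :=
  [the n.+1.-tuple T of x.1 :: x.2].

Let measurable_tuple_consp n : measurable_fun setT (@tuple_consp n).
Proof. by apply: measurable_cons; [exact: measurable_fst|exact: measurable_snd]. Qed.

HB.instance Definition _ n :=
  isMeasurableFun.Build _ _ _ _ (@tuple_consp n) (@measurable_tuple_consp n).

(* The product of [mu ord0], [mu 1], ... on the product sigma-algebra of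
   [n.-tuple T], transported along [T * T^n = T^(n+1)]. *)
Fixpoint tuple_product n : ('I_n -> probability T R) -> probability (n.-tuple T) R :=
  match n with
  | 0 => fun _ => dirac [tuple]
  | m.+1 => fun mu =>
      distribution (mu ord0 \x tuple_product (fun i => mu (lift ord0 i)))%E
                   (@tuple_consp m)
  end.

Definition tuple_power n (mu : probability T R) : probability (n.-tuple T) R :=
  tuple_product (fun _ : 'I_n => mu).

End tuple_product.

Section dirichlet.
Context (R : realType).

Definition gamma_weight (a x : R) : R :=
  ((fun y => y `^ (a - 1) * expR (- y)) \_ `]0, +oo[) x.

Definition gamma_measure (a : R) (B : set R) : \bar R :=
  (\int[lebesgue_measure]_(x in B) (gamma_weight a x)%:E)%E.

Section gamma_measure.
Variable a : R.

Let gamma_weight_ge0 x : 0 <= gamma_weight a x.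
Proof. by apply: restrict_ge0 => {}x _; rewrite mulr_ge0 ?powR_ge0 ?expR_ge0. Qed.

Let measurable_gamma_weight : measurable_fun setT (gamma_weight a).
Proof.
apply/measurable_restrict => //; apply: measurable_funTS.
apply: measurable_funM => /=; first exact: measurable_powR.
exact: measurableT_comp.
Qed.

Let gamma_measure0 : gamma_measure a set0 = 0%E.
Proof. by rewrite /gamma_measure integral_set0. Qed.

Let gamma_measure_ge0 B : (0 <= gamma_measure a B)%E.
Proof. by apply: integral_ge0 => x _; rewrite lee_fin. Qed.

Let gamma_measure_sigma_additive : semi_sigma_additive (gamma_measure a).
Proof.
move=> /= F mF tF mUF; rewrite /gamma_measure; apply: cvg_toP.
  apply: ereal_nondecreasing_is_cvgn => m n mn.
  apply: lee_sum_nneg_natr => // k _ _; apply: integral_ge0 => /= x Fkx.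
  by rewrite lee_fin.
rewrite ge0_integral_bigcup//=.
- exact/measurable_funTS/measurableT_comp.
- by move=> x _; rewrite lee_fin.
Qed.

HB.instance Definition _ := isMeasure.Build _ _ _ (gamma_measure a)
  gamma_measure0 gamma_measure_ge0 gamma_measure_sigma_additive.

End gamma_measure.

(* Gamma distribution of shape [a >= 0] and unit rate; shape 0 is the unit mass
   at 0, so that Dirichlet laws allow vanishing parameters. *)
Definition gamma_prob (a : R) : probability R R :=
  if a == 0 then [the probability R R of dirac (0 : R)]
  else [the probability R R of mnormalize (gamma_measure a) (dirac (0 : R))].

Definition proportions n (z : n.-tuple R) : n.-tuple R :=
  [tuple tnth z i / \sum_(j < n) tnth z j | i < n].

(* Law of [(Z_1, ..., Z_n) / (Z_1 + ... + Z_n)] for independent [Z_i] with Gamma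
   distribution of shape [a i]; meaningful when all [a i >= 0] and one is positive. *)
Definition dirichlet n (a : 'I_n -> R) : set (n.-tuple R) -> \bar R :=
  pushforward (tuple_product (fun i => gamma_prob (a i))) (@proportions n).

End dirichlet.

Section polya.
Context (R : realType) (A : ptopologicalType).
Variable alpha : {measure set (borel A) -> \bar R}.

(* Iterated integral over [a_1 \in B_1, a_2 \in B_2, ...] of the Polya predictive
   probabilities, [past] being the list of values already drawn. *)
Fixpoint polya_law (past : seq (borel A)) (Bs : seq (set (borel A))) : \bar R :=
  if Bs is B :: Bs' then
    (((fine (alpha setT) + (size past)%:R)^-1)%:E *
     \int[measure_add alpha
            (msum (fun l => dirac (nth point past l)) (size past))]_(a in B)
       polya_law (rcons past a) Bs')%E
  else 1%E.

Context d (Omega : measurableType d) (P : probability Omega R).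

(* [X n] is the (n+1)-st term of the sequence. *)
Definition polya_sequence (X : nat -> {RV P >-> borel A}) : Prop :=
  forall (k : nat) (j : 'I_k -> nat) (B : 'I_k -> set (borel A)),
    (0 < k)%N ->
    {homo j : i l / (i < l)%N} ->
    (forall i, measurable (B i)) ->
    P (\bigcap_(i in [set: 'I_k]) (X (j i) @^-1` B i)) =
      polya_law [::] [seq B i | i <- enum 'I_k].

(* A random probability measure is a random variable with values in [pprobability],
   whose sigma-algebra is generated by the evaluations on measurable sets. *)
Definition dirichlet_ferguson (D : {RV P >-> pprobability (borel A) R}) : Prop :=
  forall (n : nat) (C : 'I_n -> set (borel A)),
    (forall i, measurable (C i)) -> trivIset setT C ->
    \bigcup_(i in [set: 'I_n]) C i = setT ->
    forall B : set (n.-tuple R), measurable B ->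
      P [set w | B [tuple fine ((D w : probability (borel A) R) (C i)) | i < n]] =
        dirichlet (fun i => fine (alpha (C i))) B.

End polya.

Section spaces.
Context (R : realType) (A : ptopologicalType).
Context d (Omega : measurableType d) (P : probability Omega R).
Variable X : nat -> {RV P >-> borel A}.
Variable D : {RV P >-> pprobability (borel A) R}.

Definition empirical_limit : Prop :=
  forall C : set (borel A), measurable C ->
    {ae P, forall w,
      (fun n : nat => ((n%:R)^-1 * \sum_(i < n) \1_C (X i w))%:E) @ \oo -->
        (D w : probability (borel A) R) C}.

Definition prefix_vector n (w : Omega) : n.-tuple (borel A) :=
  [tuple X i w | i < n].

Definition sigma_of d' (T : measurableType d') (Y : Omega -> T) : set (set Omega) :=
  preimage_set_system setT Y measurable.

Definition is_cond_expectation (G : set (set Omega)) (f g : Omega -> R) : Prop :=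
  [/\ P.-integrable setT (EFin \o f),
      P.-integrable setT (EFin \o g),
      forall B : set R, measurable B -> G (g @^-1` B) &
      forall E, G E ->
        (\int[P]_(w in E) (f w)%:E = \int[P]_(w in E) (g w)%:E)%E].

Definition symmetric_fun n (h : n.-tuple (borel A) -> R) : Prop :=
  forall (s : 'S_n) t, h [tuple tnth t (s i) | i < n] = h t.

(* For [n = 1], [prefix_vector 0] is constant, and the last condition says that the
   expectation of [h (X_1)] vanishes. *)
Definition Xi n (h : n.-tuple (borel A) -> R) : Prop :=
  [/\ symmetric_fun h,
      measurable_fun setT h,
      ('E_P[fun w => (h (prefix_vector n w) ^+ 2)%R] < +oo)%E &
      is_cond_expectation (sigma_of (prefix_vector n.-1))
        (h \o prefix_vector n) (cst 0)].

Definition sigma_D : set (set Omega) :=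
  <<s \bigcup_(C in measurable)
        sigma_of (fun w => (D w : probability (borel A) R) C) >>.

(* Elements are representatives: random variables, not classes modulo [P]-a.e.
   equality. *)
Definition L2_D : set (Omega -> R) :=
  [set Y | (forall B : set R, measurable B -> sigma_D (Y @^-1` B)) /\
           ('E_P[fun w => (Y w ^+ 2)%R] < +oo)%E].

Definition L2_cvg (u : nat -> Omega -> R) (Y : Omega -> R) : Prop :=
  (fun K => ('E_P[fun w => ((u K w - Y w) ^+ 2)%R])%E) @ \oo --> 0%E.

(* An integral equal to a real number is that of an integrable function: the
   library's convention makes an undefined integral infinite. *)
Definition M_D n : set (Omega -> R) :=
  [set Y | L2_D Y /\ exists2 h, @Xi n h &
     {ae P, forall w,
       (Y w)%:E = (\int[tuple_power n (D w : probability (borel A) R)]_t (h t)%:E)%E}].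

Definition U_statistic n (h : n.-tuple (borel A) -> R) (K : nat) (w : Omega) : R :=
  ('C(K, n)%:R)^-1 *
  \sum_(j : n.-tuple 'I_K | sorted ltn (map val j))
    h [tuple X (tnth j i) w | i < n].

Definition closed_subspace_L2_D (V : set (Omega -> R)) : Prop :=
  [/\ V `<=` L2_D,
      V (cst 0),
      forall (a : R) Y Z, V Y -> V Z -> V (fun w => a * Y w + Z w) &
      forall (u : nat -> Omega -> R) Y,
        (forall n, V (u n)) -> L2_D Y -> L2_cvg u Y -> V Y].

Definition U_limits n : set (Omega -> R) :=
  [set Y | L2_D Y /\ exists2 h, @Xi n h & L2_cvg (U_statistic h) Y].

End spaces.

(* Main.v *)
(* Write [I h] for the integral of [h] with respect to the [N]-fold power of [D].
   Averaging over the copies of [X_j] with [j] large (Cesaro limits) identifies the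
   joint law of finitely many [X_j] and of finitely many masses of [D]; hence,
   given [D], the sequence is i.i.d. with law [D].

   For a square-integrable kernel [h], two terms of the U-statistic with disjoint
   index sets have uncorrelated deviations from [I h], and the proportion of pairs of
   overlapping index sets among ['C(K, N) ^ 2] is at most [N ^ 2 / K]; so the
   U-statistics of [h] tend to [I h] in L2, and the set of limits is [M_N(D)].

   It remains to see that [M_N(D)] is closed. By the urn rule, a new variable is drawn
   from [alpha] or copies an earlier one. If [h] is degenerate, replacing the indices
   of [h(X_1, ..., X_N)] one at a time by new ones multiplies its correlation with
   itself by explicit positive constants, so that the second moment of [I h] is
   [c > 0] times that of [h(X_1, ..., X_N)]. Therefore [h |-> I h] is, up to a factor,
   an isometry, and its image is complete because the degenerate kernels are closed
   in L2. *)

Require Import Defs.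
From HB Require Import structures.
From mathcomp Require Import all_boot all_order perm all_algebra.
From mathcomp Require Import all_classical all_reals all_analysis.
From mathcomp Require Import measurable_realfun giry.
From mathcomp Require Import ring lra zify.

Set Implicit Arguments.
Unset Strict Implicit.
Unset Printing Implicit Defensive.
Import Order.TTheory GRing.Theory Num.Theory.
Import numFieldNormedType.Exports.

Local Open Scope classical_set_scope.
Local Open Scope ring_scope.

(** * Products and mixtures of measures *)

(** Everything probabilistic passes through a function [Q] of lists of sets, the law of distinct
    terms of the sequence on a box. The urn formula gives it for increasing indices only, and its
    iterated integrals do not look symmetric. Symmetry is not computed: mixed moments of the masses
    of [D] are values of [Q] as well, and they visibly ignore the order of the sets. After that only
    three facts about [Q] are used: it integrates products of indicators and masses ([XDQ]), it is
    symmetric ([Q_perm]), and it satisfies the urn rule for a last side ([Q_rcons]).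

    The second moment of [I h] closes up for the following reason. When a new variable enters [h]
    next to [X_s], a draw from the initial urn and the copies of entries of [X_s] together make up
    the conditional mean of [h] given [X_s], which vanishes. Any other copy increases by one the
    number of indices shared with the second factor, so an induction ends at the second moment of
    [h].

    Kernels and random variables are functions, not classes: [I h] has to be total and exactly
    measurable for the sigma-algebra of [D], and a limit kernel has to be symmetric everywhere. *)

Definition box (T : Type) n (B : 'I_n -> set T) : set (n.-tuple T) :=
  [set t | forall i, B i (tnth t i)].

Definition boxes d (T : measurableType d) n : set (set (n.-tuple T)) :=
  [set box B | B in [set B : 'I_n -> set T | forall i, measurable (B i)]].
Arguments boxes {d} T n.

Section boxes.
Context d (T : measurableType d) (n : nat).

Lemma measurable_box (B : 'I_n -> set T) :
  (forall i, measurable (B i)) -> measurable (box B).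
Proof.
move=> mB; rewrite (_ : box B = \big[setI/setT]_(i < n) ((@tnth n T)^~ i @^-1` B i)).
  apply: bigsetI_measurable => i _.
  by rewrite -[X in measurable X]setTI; exact: measurable_tnth.
rewrite -bigcap_seq; apply/seteqP; split => t /= Bt i; first by move=> _; exact: Bt.
by apply: (Bt i); rewrite /= mem_index_enum.
Qed.

Lemma boxes_setT : boxes T n setT.
Proof. by exists (fun=> setT) => //; apply/seteqP; split. Qed.

Lemma boxes_setI : setI_closed (boxes T n).
Proof.
move=> _ _ [B mB <-] [C mC <-]; exists (fun i => B i `&` C i).
  by move=> i; exact: measurableI.
by apply/seteqP; split => t /= => [BC|[Bt Ct] i]; [split=> i; have [] := BC i|split].
Qed.

Lemma measurable_tuple_boxes : @measurable _ (n.-tuple T) = <<s boxes T n >>.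
Proof.
apply/seteqP; split; last first.
  apply: smallest_sub; first exact: sigma_algebra_measurable.
  by move=> _ [B mB <-]; exact: measurable_box.
apply: smallest_sub; first exact: smallest_sigma_algebra.
rewrite -bigcup_seq => S [i _ [B mB <-]]; apply: sub_sigma_algebra.
exists (fun j => if j == i then B else setT); first by move=> j; case: ifP.
apply/seteqP; split => t /=; first by move=> /(_ i); rewrite eqxx.
by move=> [_ Bt] j; case: eqP => [->|].
Qed.

End boxes.

Lemma finite_measure_unique d (T : measurableType d) (R : realType)
    (G : set (set T)) (m1 m2 : {measure set T -> \bar R}) :
  @measurable _ T = <<s G >> -> setI_closed G -> G setT ->
  (m1 setT < +oo)%E -> (forall S, G S -> m1 S = m2 S) ->
  forall S, measurable S -> m1 S = m2 S.
Proof.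
move=> mG GI GT m1oo m12 S mS.
by apply: (measure_unique G (fun=> setT)) => //; rewrite bigcup_const.
Qed.

(** A measurable rectangle is the intersection of two strips and, since [setT] belongs to both
    generating families, each strip is generated through a single coordinate. Joint laws can thus be
    compared on products of boxes. *)
Lemma prod_measure_unique d1 d2 (T1 : measurableType d1) (T2 : measurableType d2)
    (R : realType) (G1 : set (set T1)) (G2 : set (set T2))
    (m1 m2 : {measure set (T1 * T2) -> \bar R}) :
  @measurable _ T1 = <<s G1 >> -> setI_closed G1 -> G1 setT ->
  @measurable _ T2 = <<s G2 >> -> setI_closed G2 -> G2 setT ->
  (m1 setT < +oo)%E -> (forall S1 S2, G1 S1 -> G2 S2 -> m1 (S1 `*` S2) = m2 (S1 `*` S2)) ->
  forall S, measurable S -> m1 S = m2 S.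
Proof.
move=> mG1 G1I G1T mG2 G2I G2T m1oo m12.
pose G := [set A `*` B | A in G1 & B in G2].
apply: (@finite_measure_unique _ _ _ G) => //; last 3 first.
- move=> _ _ [A1 GA1 [A2 GA2 <-]] [B1 GB1 [B2 GB2 <-]].
  exists (A1 `&` B1); first exact: G1I.
  by exists (A2 `&` B2); [exact: G2I|rewrite setXI].
- by exists setT => //; exists setT => //; rewrite setXTT.
- by move=> _ [A GA [B GB <-]]; exact: m12.
apply/seteqP; split; last first.
  apply: smallest_sub; first exact: sigma_algebra_measurable.
  move=> _ [A GA [B GB <-]]; apply: measurableX.
    by rewrite mG1; exact: sub_sigma_algebra.
  by rewrite mG2; exact: sub_sigma_algebra.
have prodl A : measurable A -> <<s G >> (A `*` setT).
  have -> : A `*` setT = @fst T1 T2 @^-1` A by apply/seteqP; split => -[? ?] //= [].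
  rewrite mG1 -[X in <<s G >> X]setTI.
  suff : measurable_fun setT (@fst T1 T2 : g_sigma_algebraType G -> T1).
    by move=> mf sA; apply: mf => //; rewrite mG1.
  apply: (measurability G1) => // _ [B GB <-]; rewrite setTI.
  apply: sub_sigma_algebra; exists B => //; exists setT => //.
  by apply/seteqP; split => -[? ?] //= [].
have prodr B : measurable B -> <<s G >> (setT `*` B).
  have -> : setT `*` B = @snd T1 T2 @^-1` B by apply/seteqP; split => -[? ?] //= [].
  rewrite mG2 -[X in <<s G >> X]setTI.
  suff : measurable_fun setT (@snd T1 T2 : g_sigma_algebraType G -> T2).
    by move=> mf sB; apply: mf => //; rewrite mG2.
  apply: (measurability G2) => // _ [A GA <-]; rewrite setTI.
  apply: sub_sigma_algebra; exists setT => //; exists A => //.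
  by apply/seteqP; split => -[? ?] //= [].
rewrite measurable_prod_measurableType.
apply: smallest_sub; first exact: smallest_sigma_algebra.
move=> _ [A mA [B mB <-]].
rewrite -[A]setIT -[B]setTI setXI.
by apply: (@measurableI _ (g_sigma_algebraType G)); [exact: prodl|exact: prodr].
Qed.

Section mixture.
Local Open Scope ereal_scope.
Context d1 d2 (Omega : measurableType d1) (T : measurableType d2) (R : realType).
Variables (P : giry Omega R) (k : Omega -> giry T R).
Hypothesis mk : measurable_fun setT k.
Let M := giry_bind P mk.

Lemma measurable_integral_giry (F : T -> \bar R) : measurable_fun setT F ->
  (forall t, 0 <= F t) -> measurable_fun setT (fun w => \int[k w]_t F t).
Proof.
by move=> mF F0; exact: (measurableT_comp (measurable_giry_int mF F0) mk).
Qed.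

Lemma ge0_integral_mixture (F : T -> \bar R) : measurable_fun setT F ->
  (forall t, 0 <= F t) -> \int[M]_t F t = \int[P]_w \int[k w]_t F t.
Proof. by move=> mF F0; exact: giry_int_bind. Qed.

Variable F : T -> \bar R.
Hypothesis iF : M.-integrable setT F.
Let mF : measurable_fun setT F. Proof. exact: measurable_int iF. Qed.

Let integrable_part (G : T -> \bar R) : measurable_fun setT G ->
  (forall t, 0 <= G t) -> (forall t, G t <= `|F t|) ->
  P.-integrable setT (fun w => \int[k w]_t G t).
Proof.
move=> mG G0 GF; apply/integrableP; split; first exact: measurable_integral_giry.
under eq_integral do rewrite gee0_abs ?integral_ge0//.
rewrite -ge0_integral_mixture//.
case/integrableP: iF => _; apply: le_lt_trans.
by apply: ge0_le_integral => //; exact: measurableT_comp.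
Qed.

(** The mean over [w] of the integrals of [|F|] is finite, which says nothing at a fixed [w]. The
    later almost sure statements about integrals against [D] come from here. *)
Lemma ae_integrable_mixture : {ae P, forall w, (k w).-integrable setT F}.
Proof.
have /integrable_ae : P.-integrable setT (fun w => \int[k w]_t `|F t|).
  by apply: integrable_part => //; exact: measurableT_comp.
move=> /(_ measurableT); apply: filterS => w /= /(_ I) foo.
apply/integrableP; split => //.
by rewrite ltey_eq foo.
Qed.

Let iFp : P.-integrable setT (fun w => \int[k w]_t F^\+ t).
Proof.
apply: integrable_part => //; first exact: measurable_funepos.
by move=> t; rewrite -[leRHS]/((abse \o F) t) fune_abse leeDl.
Qed.

Let iFn : P.-integrable setT (fun w => \int[k w]_t F^\- t).
Proof.
apply: integrable_part => //; first exact: measurable_funeneg.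
by move=> t; rewrite -[leRHS]/((abse \o F) t) fune_abse leeDr.
Qed.

Lemma integrable_mixture : P.-integrable setT (fun w => \int[k w]_t F t).
Proof.
have := integrableB measurableT iFp iFn; apply: eq_integrable => // w _.
by rewrite [RHS]integralE.
Qed.

(** Fubini for a kernel in place of a product. Both parts of [F] have integrable inner integrals, so
    their difference can be integrated although it may be infinite minus infinite on a null set. *)
Lemma integral_mixture : \int[M]_t F t = \int[P]_w \int[k w]_t F t.
Proof.
rewrite integralE !ge0_integral_mixture//; last 2 first.
- exact: measurable_funeneg.
- exact: measurable_funepos.
under [RHS]eq_integral do rewrite integralE.
by rewrite -(integralB measurableT iFp iFn).
Qed.

End mixture.

Section integral_tensor.
Local Open Scope ereal_scope.
Context d1 d2 (T1 : measurableType d1) (T2 : measurableType d2) (R : realType).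
Variables (m1 : subprobability T1 R) (m2 : subprobability T2 R).
Variables (f : T1 -> R) (g : T2 -> R).
Hypotheses (if1 : m1.-integrable setT (EFin \o f)) (ig : m2.-integrable setT (EFin \o g)).

Let mf : measurable_fun setT f.
Proof. exact/measurable_EFinP/(measurable_int _ if1). Qed.

Let mg : measurable_fun setT g.
Proof. exact/measurable_EFinP/(measurable_int _ ig). Qed.

Let mfg : measurable_fun setT (fun z : T1 * T2 => (f z.1 * g z.2)%:E).
Proof.
by apply/measurable_EFinP/measurable_funM; exact: measurableT_comp.
Qed.

Lemma integrable_tensor :
  (m1 \x m2).-integrable setT (fun z => (f z.1 * g z.2)%:E).
Proof.
apply/integrable12ltyP => //=.
under eq_integral => x _.
  under eq_integral do rewrite normrM EFinM.
  rewrite ge0_integralZl//; last exact/measurable_EFinP/measurableT_comp.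
  over.
case/integrableP : if1 => _ foo; case/integrableP : ig => _ goo.
rewrite ge0_integralZr//; last 2 first.
- exact/measurable_EFinP/measurableT_comp.
- exact: integral_ge0.
by rewrite lte_mul_pinfty// ?integral_ge0// ge0_fin_numE ?integral_ge0.
Qed.

(** Applied to two copies of a power of [D w], it turns the square of an integral into the integral
    of a product kernel, so that second moments are governed by joint laws. *)
Lemma integral_tensor : \int[m1 \x m2]_z (f z.1 * g z.2)%:E =
  (\int[m1]_x (f x)%:E) * (\int[m2]_y (g y)%:E).
Proof.
rewrite -(integral12_prod_meas1 integrable_tensor) /fubini_F/=.
under eq_integral => x _ do under eq_integral do rewrite EFinM.
have gfin : \int[m2]_y (g y)%:E \is a fin_num by exact: integrable_fin_num.
under eq_integral do rewrite integralZl//.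
by rewrite -(fineK gfin) integralZr.
Qed.

End integral_tensor.

Lemma measurable_nth d d' (S : measurableType d') (T : measurableType d) (x0 : T) n k
    (f : S -> n.-tuple T) : measurable_fun setT f ->
  measurable_fun setT (fun s => nth x0 (f s) k).
Proof.
move=> mf; have [kn|nk] := ltnP k n; last first.
  rewrite (_ : (fun s => _) = cst x0); first exact: measurable_cst.
  by apply/funext => s; rewrite nth_default ?size_tuple.
rewrite (_ : (fun s => _) = (fun t : n.-tuple T => tnth t (Ordinal kn)) \o f).
  exact: (measurableT_comp (measurable_tnth _) mf).
by apply/funext => s /=; rewrite (tnth_nth x0).
Qed.

Lemma measurable_mktuple d d' (S : measurableType d') (T : measurableType d) n
    (f : 'I_n -> S -> T) : (forall i, measurable_fun setT (f i)) ->
  measurable_fun setT (fun s => [tuple f i s | i < n]).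
Proof.
move=> mf; apply/measurable_fun_tnthP => i.
by rewrite (_ : _ \o _ = f i)//; apply/funext => s /=; rewrite tnth_mktuple.
Qed.

Lemma measurable_rcons d (T : measurableType d) (x0 : T) n :
  measurable_fun setT
    (fun z : n.-tuple T * T => [the n.+1.-tuple T of rcons z.1 z.2]).
Proof.
apply/measurable_fun_tnthP => i.
rewrite (_ : _ \o _ = fun z : n.-tuple T * T =>
    if (i < n)%N then nth x0 z.1 i else z.2); last first.
  apply/funext => z /=; rewrite (tnth_nth x0) /= nth_rcons size_tuple.
  by case: ltnP => // ni; rewrite eqn_leq -ltnS ltn_ord ni.
by case: (i < n)%N; [exact: (measurable_nth _ _ measurable_fst)|exact: measurable_snd].
Qed.

(** * The Polya urn *)

Section polya_law_theory.
Local Open Scope ereal_scope.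
Context (R : realType) (A : ptopologicalType).
Variable alpha : {finite_measure set (borel A) -> \bar R}.
Local Notation L := (polya_law alpha).
Local Notation theta := (fine (alpha setT)).

(** Names the measure inside [polya_law], so that [polya_law_cons] holds by conversion. *)
Definition polya_urn (past : seq (borel A)) : {measure set (borel A) -> \bar R} :=
  measure_add alpha (msum (fun l => dirac (nth point past l)) (size past)).

Lemma polya_urnE past C :
  polya_urn past C = alpha C + \sum_(l < size past) \d_(nth point past l) C.
Proof. exact: measure_addE. Qed.

Lemma polya_urn_rcons past a C :
  polya_urn (rcons past a) C = polya_urn past C + \d_a C.
Proof.
rewrite !polya_urnE size_rcons big_ord_recr/= -addeA; congr (_ + (_ + _)).
  by apply: eq_bigr => i _; rewrite nth_rcons ltn_ord.
by rewrite nth_rcons ltnn eqxx.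
Qed.

Lemma polya_law_ge0 Bs past : 0 <= L past Bs.
Proof.
elim: Bs past => [|B Bs IH] past //=; rewrite mule_ge0// ?lee_fin.
  by rewrite invr_ge0 addr_ge0// fine_ge0.
by apply: integral_ge0 => a _; exact: IH.
Qed.

(** The induction needs all lengths [n] at once, since each draw lengthens the past by one. *)
Lemma measurable_polya_law Bs n : (forall B, B \in Bs -> measurable B) ->
  measurable_fun setT (fun t : n.-tuple (borel A) => L t Bs).
Proof.
elim: Bs n => [|B Bs IH] n mBs //.
have mB : measurable B by apply: mBs; rewrite inE eqxx.
have mBs' C : C \in Bs -> measurable C by move=> CBs; apply: mBs; rewrite inE CBs orbT.
have mL := IH n.+1 mBs'.
pose f (z : n.-tuple (borel A) * borel A) := L (rcons z.1 z.2) Bs.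
have mf : measurable_fun setT f.
  by have /(measurableT_comp mL) := measurable_rcons (point : borel A) (n := n).
have mnth l : measurable_fun setT (fun t : n.-tuple (borel A) => nth point t l).
  exact: (measurable_nth _ _ (@measurable_id _ _ _)).
have f0 z : 0 <= f z by exact: polya_law_ge0.
have mfx (t : n.-tuple (borel A)) : measurable_fun setT (fun a => f (t, a)).
  exact: measurableT_comp.
(* Integrating against the urn means integrating against [alpha], which is measurable in the past by
   Tonelli, and adding finitely many evaluations at past values. *)
rewrite (_ : (fun t => _) = fun t : n.-tuple (borel A) => ((theta + n%:R)^-1)%:E *
    (\int[alpha]_a (f (t, a) * (\1_B a)%:E) +
     \sum_(l < n) (\1_B (nth point t l))%:E * f (t, nth point t l))); last first.
  apply/funext => t /=; rewrite size_tuple; congr (_ * _).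
  rewrite ge0_integral_measure_add//; last 2 first.
  - by move=> a _; exact: polya_law_ge0.
  - exact: measurable_funTS (mfx t).
  congr (_ + _).
    rewrite integral_mkcond; apply: eq_integral => a _.
    by rewrite epatch_indic.
  rewrite ge0_integral_measure_sum//; last 2 first.
  - by move=> a _; exact: polya_law_ge0.
  - exact: measurable_funTS (mfx t).
  apply: eq_bigr => l _; rewrite integral_dirac//.
  exact: measurable_funTS (mfx t).
apply: measurable_funeM; apply: emeasurable_funD.
  apply: (measurable_fun_fubini_tonelli_F
    (fun z : n.-tuple (borel A) * borel A => f z * (\1_B z.2)%:E)).
    apply: emeasurable_funM => //; apply/measurable_EFinP.
    exact: measurableT_comp.
  by move=> z; rewrite mule_ge0.
apply: emeasurable_sum => l; apply: emeasurable_funM.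
  by apply/measurable_EFinP; apply: (measurableT_comp _ (mnth l)); exact: measurable_indic.
by have /(measurableT_comp mf) := measurable_fun_pair (@measurable_id _ _ _) (mnth l).
Qed.

End polya_law_theory.

Section polya_law_rcons.
Local Open Scope ereal_scope.
Context (R : realType) (A : ptopologicalType).
Variable alpha : {finite_measure set (borel A) -> \bar R}.
Local Notation L := (polya_law alpha).
Local Notation theta := (fine (alpha setT)).
Hypothesis alpha_gt0 : 0 < alpha setT.

Lemma theta_gt0 : (0 < theta)%R.
Proof. by rewrite fine_gt0// alpha_gt0/= ltey_eq fin_num_measure. Qed.

Lemma polya_law_cons past B Bs : L past (B :: Bs) =
  ((theta + (size past)%:R)^-1)%:E *
  \int[polya_urn alpha past]_(a in B) L (rcons past a) Bs.
Proof. by []. Qed.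

(* The last value drawn is compared to the urn at that time: a ball of the initial
   urn, of the past, or one of the values drawn since. *)
Lemma polya_law_rcons Bs C past : (forall B, B \in Bs -> measurable B) ->
  measurable C ->
  (theta + (size past + size Bs)%:R)%:E * L past (rcons Bs C) =
  polya_urn alpha past C * L past Bs +
  \sum_(l < size Bs) L past (set_nth setT Bs l (nth setT Bs l `&` C)).
Proof.
have th0 := theta_gt0.
have cK q : (theta + q%:R)%:E * (theta + q%:R)^-1%:E = 1 :> \bar R.
  by rewrite -EFinM divff// gt_eqF// ltr_wpDr.
have c0 q : 0 <= (theta + q%:R)^-1%:E :> \bar R.
  by rewrite lee_fin invr_ge0 addr_ge0// ltW.
elim: Bs past => [|B Bs IH] past mBs mC.
  rewrite big_ord0 adde0 addn0 [rcons _ _]/=.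
  rewrite [L past [::]]/= mule1 [L past _]/= muleA cK mul1e.
  by rewrite integral_cst// mul1e.
have mB : measurable B by apply: mBs; rewrite inE eqxx.
have mBs' D : D \in Bs -> measurable D by move=> DBs; apply: mBs; rewrite inE DBs orbT.
have mL Ds : (forall D, D \in Ds -> measurable D) ->
    measurable_fun setT (fun a => L (rcons past a) Ds).
  move=> mDs; have := measurable_rcons (point : borel A) (n := size past).
  move=> /(measurableT_comp (measurable_polya_law alpha mDs)) mf.
  exact: (measurableT_comp mf (measurable_pair1 (in_tuple past))).
have mset l D : D \in set_nth setT Bs l (nth setT Bs l `&` C) -> measurable D.
  move=> /(nthP setT)[i _ <-]; rewrite nth_set_nth /=; case: eqP => _.
    apply: measurableI => //.
    by have [/(mem_nth setT)/mBs'//|/(nth_default setT)->//] := ltnP l (size Bs).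
  by have [/(mem_nth setT)/mBs'//|/(nth_default setT)->//] := ltnP i (size Bs).
have L0 a Ds : 0 <= L (rcons past a) Ds by exact: polya_law_ge0.
rewrite rcons_cons !polya_law_cons.
have urnr a := polya_urn_rcons alpha past a C.
set m := polya_urn alpha past in urnr *.
have i0 E Ds : 0 <= \int[m]_(a in E) L (rcons past a) Ds by apply: integral_ge0.
(* The term of index 0 shrinks the first side and the others shrink a later one; all carry the
   normalizing factor of the first draw. *)
have -> : \sum_(l < size (B :: Bs)) L past (set_nth setT (B :: Bs) l (nth setT (B :: Bs) l `&` C)) =
    ((theta + (size past)%:R)^-1)%:E * (\int[m]_(a in B `&` C) L (rcons past a) Bs +
     \sum_(l < size Bs) \int[m]_(a in B)
        L (rcons past a) (set_nth setT Bs l (nth setT Bs l `&` C))).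
  by rewrite [RHS]ge0_muleDr ?sume_ge0// ge0_sume_distrr// big_ord_recl.
rewrite muleCA [m C * _]muleCA -ge0_muleDr; last 2 first.
- by rewrite mule_ge0.
- by rewrite adde_ge0 ?sume_ge0.
congr (_ * _).
rewrite -ge0_integralZl//; last 2 first.
- apply: measurable_funTS; apply: mL => D; rewrite mem_rcons inE => /predU1P[->//|].
  exact: mBs'.
- by rewrite lee_fin addr_ge0// ltW.
under eq_integral => a _.
  rewrite addnS -addSn -(size_rcons past a) IH// urnr ge0_muleDl//.
  over.
rewrite ge0_integralD//; last 4 first.
- by move=> a _; rewrite adde_ge0// mule_ge0.
- apply: emeasurable_funD; apply: emeasurable_funM => //; try exact: measurable_funTS (mL _ mBs').
  exact: measurable_fun_dirac.
- by move=> a _; exact: sume_ge0.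
- by apply: emeasurable_sum => l; apply: measurable_funTS; exact: mL (mset _).
rewrite ge0_integralD//; last 4 first.
- by move=> a _; rewrite mule_ge0.
- by apply: emeasurable_funM => //; exact: measurable_funTS (mL _ mBs').
- by move=> a _; rewrite mule_ge0.
- apply: emeasurable_funM; last exact: measurable_funTS (mL _ mBs').
  exact: measurable_fun_dirac.
rewrite ge0_integralZl//; last exact: measurable_funTS (mL _ mBs').
rewrite -addeA; congr (_ + (_ + _)).
  (* The ball [a] added by the first draw contributes [\d_a C], which cuts the integral over [B]
     down to the intersection of [B] and [C]. *)
  rewrite integral_mkcondr; apply: eq_integral => a _.
  by rewrite epatch_indic muleC.
rewrite ge0_integral_sum// => l; apply: measurable_funTS; exact: mL (mset _).
Qed.

End polya_law_rcons.

(** * The sequence and its directing measure *)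

Section cesaro_expectation.
Context d (Omega : measurableType d) (R : realType) (P : probability Omega R).

Lemma measurable_unit_integrable (f : Omega -> R) : measurable_fun setT f ->
  (forall w, 0 <= f w <= 1) -> P.-integrable setT (EFin \o f).
Proof.
move=> mf f01; apply: (le_integrable measurableT _ _
    (finite_measure_integrable_cst P 1 measurableT)).
  exact/measurable_EFinP.
by move=> w _ /=; rewrite lee_fin normr1 ger0_norm; have /andP[] := f01 w.
Qed.

(** [G] will be built from masses of [D] and from terms of index below [M]. The averages are bounded
    by 1, so dominated convergence applies, and the finitely many early terms, whose correlation
    with [G] is unknown, disappear in the Cesaro mean. *)
Lemma cesaro_expectation (G Z : Omega -> R) (Y : nat -> Omega -> R) (c : R) (M : nat) :
  measurable_fun setT G -> (forall w, 0 <= G w <= 1) ->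
  measurable_fun setT Z ->
  (forall i, measurable_fun setT (Y i)) -> (forall i w, 0 <= Y i w <= 1) ->
  {ae P, forall w, (fun n : nat => ((n%:R)^-1 * \sum_(i < n) Y i w)%:E) @ \oo --> (Z w)%:E} ->
  (forall i, (M <= i)%N -> (\int[P]_w (G w * Y i w)%:E = c%:E)%E) ->
  (\int[P]_w (G w * Z w)%:E = c%:E)%E.
Proof.
move=> mG G01 mZ mY Y01 YZ GYc.
have GY01 i w : 0 <= G w * Y i w <= 1.
  have /andP[G0 G1] := G01 w; have /andP[Y0 Y1] := Y01 i w.
  by rewrite mulr_ge0//= mulr_ile1.
have mGY i : measurable_fun setT (fun w => G w * Y i w) by exact: measurable_funM.
have iGY i := measurable_unit_integrable (mGY i) (GY01 i).
pose a i := fine (\int[P]_w (G w * Y i w)%:E)%E.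
have aE i : (\int[P]_w (G w * Y i w)%:E = (a i)%:E)%E.
  by rewrite fineK//; exact: integrable_fin_num (iGY i).
have ac : a @ \oo --> c.
  apply: cvg_near_cst; exists M => // i /= Mi.
  by apply: EFin_inj; rewrite -aE GYc.
(* The shift by one follows the convention of [arithmetic_mean], to which the expectations of these
   averages are matched below. *)
pose S n w := (n.+1%:R)^-1 * \sum_(i < n.+1) (G w * Y i w).
have mS n : measurable_fun setT (S n).
  by apply: measurable_funM => //; exact: measurable_sum.
have [_ _] : [/\ P.-integrable setT (fun w => (G w * Z w)%:E),
    (fun n => \int[P]_w `|(S n w)%:E - (G w * Z w)%:E|)%E @ \oo --> 0%E &
    (fun n => \int[P]_w (S n w)%:E)%E @ \oo --> (\int[P]_w (G w * Z w)%:E)%E].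
  apply: (@dominated_convergence _ _ _ P _ measurableT (fun n w => (S n w)%:E) _ (cst 1%E)).
  - by move=> n; exact/measurable_EFinP.
  - exact/measurable_EFinP/measurable_funM.
  - apply: filterS YZ => w /= YZ _.
    have /fine_cvgP[_] := YZ; rewrite -cvg_shiftS => {}YZ.
    apply: cvg_EFin; first exact: nearW.
    rewrite (_ : fine \o _ = (fun n => G w * ((n.+1%:R)^-1 * \sum_(i < n.+1) Y i w))).
      exact: cvgMr YZ.
    by apply/funext => n /=; rewrite /S -mulr_sumr mulrCA.
  - exact: finite_measure_integrable_cst.
  - apply/aeW => w n _ /=; rewrite lee_fin ger0_norm; last first.
      by rewrite mulr_ge0// sumr_ge0// => i _; have /andP[] := GY01 i w.
    rewrite /S mulrC ler_pdivrMr// mul1r.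
    have : \sum_(i < n.+1) G w * Y i w <= \sum_(i < n.+1) 1.
      by apply: ler_sum => i _; have /andP[] := GY01 i w.
    by rewrite sumr_const card_ord.
rewrite [X in X @ \oo --> _](_ : _ = EFin \o arithmetic_mean a); last first.
  apply/funext => n /=; rewrite /S.
  under eq_integral do rewrite EFinM -sumEFin.
  rewrite integralZl//; last first.
    by apply: integrable_sum => // i _; exact: iGY.
  rewrite integral_sum//; last by move=> i; exact: iGY.
  under eq_bigr do rewrite aE.
  by rewrite sumEFin -EFinM /arithmetic_mean /series /= big_mkord.
move=> h1; apply: (cvg_unique _ h1) => //; apply: cvg_EFin; first exact: nearW.
exact: cesaro.
Qed.

End cesaro_expectation.

(* [Q] gives the finite-dimensional laws of [X] on products of measurable sets. *)
Section directing_measure.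
Context d (Omega : measurableType d) (R : realType) (P : probability Omega R).
Context d' (T : measurableType d').
Variables (X : nat -> {RV P >-> T}) (D : {RV P >-> pprobability T R}).
Variable Q : seq (set T) -> \bar R.

Let DP w : probability T R := D w.

Hypothesis XQ : forall s : seq (nat * set T), sorted ltn (map fst s) ->
  (forall p, p \in s -> measurable p.2) ->
  (\int[P]_w (\prod_(p <- s) \1_(p.2) (X p.1 w))%:E = Q (map snd s))%E.

Hypothesis limD : forall C, measurable C -> {ae P, forall w,
  (fun n : nat => ((n%:R)^-1 * \sum_(i < n) \1_C (X i w))%:E) @ \oo --> DP w C}.

Lemma measurable_directing C : measurable C ->
  measurable_fun setT (fun w => (DP w C : \bar R)).
Proof.
move=> mC; exact: (measurable_kernel (kprobability (measurable_funP D)) C mC).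
Qed.

Lemma measurable_fine_directing C : measurable C ->
  measurable_fun setT (fun w => fine (DP w C)).
Proof.
by move=> mC; apply: measurableT_comp => //; exact: measurable_directing.
Qed.

Lemma fine_directing01 C w : measurable C -> 0 <= fine (DP w C) <= 1.
Proof.
move=> mC; have fC : DP w C \is a fin_num by exact: fin_num_measure.
by rewrite -!lee_fin fineK// measure_ge0 probability_le1.
Qed.

Lemma prod01 (I : eqType) (s : seq I) (f : I -> R) :
  (forall i, i \in s -> 0 <= f i <= 1) -> 0 <= \prod_(i <- s) f i <= 1.
Proof.
move=> f01; rewrite big_seq; elim/big_rec: _ => [|i x si /andP[x0 x1]].
  by rewrite ler01 lexx.
by have /andP[f0 f1] := f01 i si; rewrite mulr_ge0//= mulr_ile1.
Qed.

Let GD (s : seq (nat * set T)) (Cs : seq (set T)) w :=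
  \prod_(p <- s) \1_(p.2) (X p.1 w) * \prod_(C <- Cs) fine (DP w C).

Lemma measurable_indic_comp C i : measurable C ->
  measurable_fun setT (fun w => \1_C (X i w) : R).
Proof. by move=> mC; apply: measurableT_comp => //; exact: measurable_indic. Qed.

Lemma indic01 (C : set T) t : 0 <= (\1_C t : R) <= 1.
Proof. by rewrite indicE; case: (_ \in _); rewrite ?lexx ler01. Qed.

Let measurable_GD s Cs : (forall p, p \in s -> measurable p.2) ->
  (forall C, C \in Cs -> measurable C) -> measurable_fun setT (GD s Cs).
Proof.
move=> ms mCs; apply: measurable_funM; apply: measurable_prod.
  by move=> p /ms mp; exact: measurable_indic_comp.
by move=> C /mCs mC; exact: measurable_fine_directing.
Qed.

Let GD01 s Cs w : (forall p, p \in s -> measurable p.2) ->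
  (forall C, C \in Cs -> measurable C) -> 0 <= GD s Cs w <= 1.
Proof.
move=> ms mCs.
have /andP[a0 a1] : 0 <= (\prod_(p <- s) \1_(p.2) (X p.1 w) : R) <= 1.
  by apply: prod01 => p _; exact: indic01.
have /andP[b0 b1] : 0 <= \prod_(C <- Cs) fine (DP w C) <= 1.
  by apply: prod01 => C /mCs; exact: fine_directing01.
by rewrite mulr_ge0//= mulr_ile1.
Qed.

(** Induction on [Cs]: the mass of [C] is the limit of averages of the indicators of [C] at [X i],
    and for large [i] such an indicator can be appended to [s]. The set [C] then passes from the
    head of [Cs] to the end of [s], which leaves the argument of [Q] unchanged. *)
Lemma directing_sorted (Cs : seq (set T)) (s : seq (nat * set T)) :
  sorted ltn (map fst s) -> (forall p, p \in s -> measurable p.2) ->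
  (forall C, C \in Cs -> measurable C) ->
  (\int[P]_w (\prod_(p <- s) \1_(p.2) (X p.1 w) *
               \prod_(C <- Cs) fine (DP w C))%:E = Q (map snd s ++ Cs))%E.
Proof.
elim: Cs s => [|C Cs IH] s sorts ms mCs.
  rewrite cats0 -XQ//; apply: eq_integral => w _.
  by rewrite big_nil mulr1.
have mC : measurable C by apply: mCs; rewrite inE eqxx.
have mCs' E : E \in Cs -> measurable E by move=> ECs; apply: mCs; rewrite inE ECs orbT.
(* Beyond every index of [s], so that appending an index at least [M] keeps the list sorted. *)
pose M := (\max_(p <- s) p.1).+1.
have sM i : (M <= i)%N -> sorted ltn (map fst (rcons s (i, C))).
  move=> Mi; case: s @M Mi sorts {IH ms} => [//|p s'] M Mi sorts.
  rewrite map_rcons /= rcons_path [path _ _ _]sorts /= last_map (leq_trans _ Mi)// ltnS.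
  by apply: (leq_bigmax_seq (F := fst)) => //; exact: mem_last.
have ms' i p : p \in rcons s (i, C) -> measurable p.2.
  by rewrite mem_rcons inE => /predU1P[->//|/ms].
have IHi i : (M <= i)%N ->
    (\int[P]_w (GD s Cs w * \1_C (X i w))%:E = Q (map snd s ++ C :: Cs))%E.
  move=> Mi; rewrite -cat_rcons -[rcons _ C](map_rcons snd s (i, C)) -IH//; last 2 first.
  - exact: sM.
  - exact: ms'.
  by apply: eq_integral => w _; congr EFin; rewrite /GD big_rcons /=; ring.
(* [cesaro_expectation] is stated with a real constant, so this value of [Q] must first be seen to
   be finite. *)
have QE : Q (map snd s ++ C :: Cs) = (fine (Q (map snd s ++ C :: Cs)))%:E.
  rewrite fineK// -(IHi M)//; apply: integrable_fin_num => //.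
  apply: measurable_unit_integrable.
    by apply: measurable_funM; [exact: measurable_GD|exact: measurable_indic_comp].
  move=> w; have /andP[a0 a1] := GD01 w ms mCs'.
  have /andP[b0 b1] := indic01 C (X M w).
  by rewrite mulr_ge0//= mulr_ile1.
rewrite QE -(@cesaro_expectation _ _ _ P (GD s Cs) (fun w => fine (DP w C))
  (fun i w => \1_C (X i w)) (fine (Q (map snd s ++ C :: Cs))) M).
- by apply: eq_integral => w _; congr EFin; rewrite /GD big_cons; ring.
- exact: measurable_GD.
- by move=> w; exact: GD01.
- exact: measurable_fine_directing.
- by move=> i; exact: measurable_indic_comp.
- by move=> i w; exact: indic01.
- apply: filterS (limD mC) => w; rewrite fineK//; exact: fin_num_measure.
- by move=> i Mi; rewrite -QE IHi.
Qed.

(* With no [X] involved the left-hand side below is symmetric in [Cs], hence so is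
   [Q]: this is the exchangeability of [X]. *)
Lemma directing_perm (Cs Cs' : seq (set T)) : (forall C, C \in Cs -> measurable C) ->
  perm_eq Cs Cs' -> Q Cs = Q Cs'.
Proof.
move=> mCs CsCs'.
have mCs' C : C \in Cs' -> measurable C by rewrite -(perm_mem CsCs'); exact: mCs.
have QE Es : (forall C, C \in Es -> measurable C) ->
    (Q Es = \int[P]_w (\prod_(C <- Es) fine (DP w C))%:E)%E.
  move=> mEs; rewrite -[LHS](@directing_sorted Es [::])//.
  by apply: eq_integral => w _; rewrite big_nil mul1r.
by rewrite !QE//; apply: eq_integral => w _; rewrite (perm_big _ CsCs').
Qed.

(** Sorting by index permutes the sides, and [Q] does not see their order. *)
Lemma directing_uniq (Cs : seq (set T)) (s : seq (nat * set T)) :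
  uniq (map fst s) -> (forall p, p \in s -> measurable p.2) ->
  (forall C, C \in Cs -> measurable C) ->
  (\int[P]_w (\prod_(p <- s) \1_(p.2) (X p.1 w) *
               \prod_(C <- Cs) fine (DP w C))%:E = Q (map snd s ++ Cs))%E.
Proof.
move=> us ms mCs; pose s' := sort (relpre fst leq) s.
have ss' : perm_eq s s' by rewrite perm_sym perm_sort.
have ms' p : p \in s' -> measurable p.2 by rewrite -(perm_mem ss'); exact: ms.
have -> : Q (map snd s ++ Cs) = Q (map snd s' ++ Cs).
  apply: directing_perm; last by rewrite perm_cat2r perm_map.
  by move=> C; rewrite mem_cat => /orP[/mapP[p /ms mp ->]|/mCs].
rewrite -directing_sorted//.
  by apply: eq_integral => w _; rewrite (perm_big _ ss').
rewrite ltn_sorted_uniq_leq -(perm_uniq (perm_map fst ss')) us/= sorted_map.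
by apply: sort_sorted => p q; exact: leq_total.
Qed.

End directing_measure.

(** * Square-integrable random variables *)

Section square_integrable.
Context d (Omega : measurableType d) (R : realType) (P : probability Omega R).
Implicit Types f g : Omega -> R.

Definition sq_integrable f : Prop :=
  measurable_fun setT f /\ (\int[P]_w (f w ^+ 2)%:E < +oo)%E.

Lemma sq_integrableP f : sq_integrable f <->
  measurable_fun setT f /\ P.-integrable setT (fun w => (f w ^+ 2)%:E).
Proof.
split=> -[mf foo]; split => //; last first.
  by case/integrableP : foo => _; under eq_integral do rewrite gee0_abs ?lee_fin ?sqr_ge0//.
apply/integrableP; split; first exact/measurable_EFinP/measurable_funX.
by under eq_integral do rewrite gee0_abs ?lee_fin ?sqr_ge0//.
Qed.

Lemma sq_integrableM f g : sq_integrable f -> sq_integrable g ->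
  P.-integrable setT (fun w => (f w * g w)%:E).
Proof.
move=> /sq_integrableP[mf if2] /sq_integrableP[mg ig2].
apply: (le_integrable measurableT _ _ (integrableD measurableT if2 ig2)).
  exact/measurable_EFinP/measurable_funM.
move=> w _ /=; rewrite lee_fin (ger0_norm (addr_ge0 (sqr_ge0 _) (sqr_ge0 _))).
rewrite ler_norml; apply/andP; split.
  rewrite -subr_ge0; have -> : f w * g w - - (f w ^+ 2 + g w ^+ 2) =
    ((f w + g w) ^+ 2 + f w ^+ 2 + g w ^+ 2) / 2 by field.
  by rewrite divr_ge0// !addr_ge0// sqr_ge0.
rewrite -subr_ge0; have -> : f w ^+ 2 + g w ^+ 2 - f w * g w =
  ((f w - g w) ^+ 2 + f w ^+ 2 + g w ^+ 2) / 2 by field.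
by rewrite divr_ge0// !addr_ge0// sqr_ge0.
Qed.

Lemma sq_integrable_cst (c : R) : sq_integrable (cst c).
Proof.
split=> //=; rewrite integral_cst//.
by rewrite [X in (_ * X)%E](@probability_setT _ _ _ P) mule1 ltry.
Qed.

Lemma sq_integrable_integrable f : sq_integrable f -> P.-integrable setT (EFin \o f).
Proof.
move=> /sq_integrableM /(_ (sq_integrable_cst 1)); apply: eq_integrable => // w _ /=.
by rewrite mulr1.
Qed.

Lemma sq_integrableD f g : sq_integrable f -> sq_integrable g ->
  sq_integrable (fun w => f w + g w).
Proof.
move=> sf sg; apply/sq_integrableP; split.
  by apply: measurable_funD; [case: sf|case: sg].
have ffg := integrableD measurableT (sq_integrableM sf sf) (sq_integrableM sf sg).
have gfg := integrableD measurableT (sq_integrableM sg sf) (sq_integrableM sg sg).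
apply: eq_integrable (integrableD measurableT ffg gfg) => // w _ /=.
by congr EFin; ring.
Qed.

Lemma sq_integrableZ (a : R) f : sq_integrable f -> sq_integrable (fun w => a * f w).
Proof.
move=> sf; apply/sq_integrableP; split; first by apply: measurable_funM => //; case: sf.
apply: eq_integrable (integrableZl measurableT (a ^+ 2) (sq_integrableM sf sf)) => // w _.
by rewrite -EFinM; congr EFin; ring.
Qed.

Lemma sq_integrableB f g : sq_integrable f -> sq_integrable g ->
  sq_integrable (fun w => f w - g w).
Proof.
move=> sf /(sq_integrableZ (-1)) /(sq_integrableD sf).
by congr sq_integrable; apply/funext => w; rewrite mulN1r.
Qed.

Lemma sq_integrable_sum (I : Type) (s : seq I) (Q : pred I) (f : I -> Omega -> R) :
  (forall i, Q i -> sq_integrable (f i)) -> sq_integrable (fun w => \sum_(i <- s | Q i) f i w).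
Proof.
move=> sf; elim: s => [|i s IH].
  by under eq_fun do rewrite big_nil; exact: sq_integrable_cst.
under eq_fun do rewrite big_cons.
by case Qi : (Q i) => //; exact: sq_integrableD (sf _ Qi) IH.
Qed.

(** Serves as the triangle inequality for squared distances; the factor 2 is harmless in limits. *)
Lemma integral_sqrD f g : measurable_fun setT f -> measurable_fun setT g ->
  (\int[P]_w ((f w + g w) ^+ 2)%:E <=
   2%:E * \int[P]_w (f w ^+ 2)%:E + 2%:E * \int[P]_w (g w ^+ 2)%:E)%E.
Proof.
move=> mf mg.
have msq (k : Omega -> R) : measurable_fun setT k -> measurable_fun setT (fun w => (k w ^+ 2)%:E).
  by move=> mk; exact/measurable_EFinP/measurable_funX.
have sq0 (k : Omega -> R) w : (0 <= (k w ^+ 2)%:E)%E by rewrite lee_fin sqr_ge0.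
rewrite -!ge0_integralZl//; try exact: msq.
rewrite -ge0_integralD//; last 4 first.
- by move=> w _; rewrite mule_ge0.
- by apply: measurable_funeM; exact: msq.
- by move=> w _; rewrite mule_ge0.
- by apply: measurable_funeM; exact: msq.
apply: ge0_le_integral => //.
- by move=> w _; rewrite lee_fin sqr_ge0.
- by apply: (msq (fun w => f w + g w)); exact: measurable_funD.
- by apply: emeasurable_funD; apply: measurable_funeM; exact: msq.
move=> w _; rewrite -!EFinM -EFinD lee_fin -subr_ge0.
have -> : 2 * f w ^+ 2 + 2 * g w ^+ 2 - (f w + g w) ^+ 2 = (f w - g w) ^+ 2 by ring.
exact: sqr_ge0.
Qed.

Lemma integral_sqrB f g (Y : Omega -> R) : measurable_fun setT f -> measurable_fun setT g ->
  measurable_fun setT Y -> (\int[P]_w ((f w - g w) ^+ 2)%:E <=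
    2%:E * \int[P]_w ((f w - Y w) ^+ 2)%:E + 2%:E * \int[P]_w ((g w - Y w) ^+ 2)%:E)%E.
Proof.
move=> mf mg mY.
have := integral_sqrD (measurable_funB mf mY) (measurable_funB mY mg).
under eq_integral do rewrite addrA subrK.
move=> /le_trans; apply; rewrite leeD2l//.
by under eq_integral do rewrite -sqrrN opprB.
Qed.

Lemma sq_integral_eq0 f : measurable_fun setT f ->
  (\int[P]_w (f w ^+ 2)%:E = 0)%E -> {ae P, forall w, f w = 0}.
Proof.
move=> mf f0.
have /ae_eq_integral_abs : measurable_fun setT (fun w => (f w ^+ 2)%:E).
  exact/measurable_EFinP/measurable_funX.
move=> /(_ P measurableT)[+ _].
under eq_integral do rewrite gee0_abs ?lee_fin ?sqr_ge0//.
move=> /(_ f0); apply: filterS => w /(_ I) /= [] /eqP.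
by rewrite sqrf_eq0 => /eqP.
Qed.

Lemma sq_integral_cvg_unique (u : nat -> Omega -> R) f g :
  (forall n, measurable_fun setT (u n)) -> measurable_fun setT f -> measurable_fun setT g ->
  (fun n => \int[P]_w ((u n w - f w) ^+ 2)%:E)%E @ \oo --> 0%E ->
  (fun n => \int[P]_w ((u n w - g w) ^+ 2)%:E)%E @ \oo --> 0%E ->
  {ae P, forall w, f w = g w}.
Proof.
move=> mu mf mg uf ug.
suff /(sq_integral_eq0 (measurable_funB mf mg)) : (\int[P]_w ((f w - g w) ^+ 2)%:E = 0)%E.
  by apply: filterS => w /eqP; rewrite subr_eq0 => /eqP.
apply/eqP; rewrite eq_le; apply/andP; split; last first.
  by apply: integral_ge0 => w _; rewrite lee_fin sqr_ge0.
have : (fun n => 2%:E * \int[P]_w ((u n w - f w) ^+ 2)%:E +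
    2%:E * \int[P]_w ((u n w - g w) ^+ 2)%:E)%E @ \oo --> (2%:E * 0 + 2%:E * 0)%E.
  by apply: cvgeD; [rewrite !mule0|exact: cvgeZl|exact: cvgeZl].
rewrite !mule0 adde0 => /cvge_to_ge; apply; apply: nearW => n.
apply: le_trans (integral_sqrB mf mg (mu n)) _.
by apply: leeD; apply: lee_wpmul2l => //; rewrite le_eqVlt; apply/orP; left; apply/eqP;
  apply: eq_integral => w _; rewrite -sqrrN opprB.
Qed.

End square_integrable.

(** For probability measures, the sets whose evaluation is measurable form a Dynkin class, so a
    generating pi-system is enough. *)
Lemma measurable_giry_generator d1 d2 (S : measurableType d1) (T : measurableType d2)
    (R : realType) (G : set (set T)) (k : S -> probability T R) :
  @measurable _ T = <<s G >> -> setI_closed G ->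
  (forall A, G A -> measurable_fun setT (fun s => k s A)) ->
  measurable_fun setT (k : S -> giry T R).
Proof.
move=> mG GI mk; apply: measurable_giry_codensity => //; rewrite mG.
apply: dynkin_induction => //.
- apply: (eq_measurable_fun (cst 1%E)) => // s _.
  by rewrite [RHS]probability_setT.
- move=> A mA kA; apply: (eq_measurable_fun (fun s => 1 - k s A)%E).
    by move=> s _; rewrite [RHS]probability_setC.
  by apply: emeasurable_funB; [exact: measurable_cst|exact: kA].
- move=> F mF tF kF; apply: (eq_measurable_fun (fun s => \sum_(n <oo) k s (F n))%E).
    by move=> s _; rewrite [RHS]measure_semi_bigcup//; exact: bigcup_measurable.
  have := @ge0_emeasurable_sum _ S R setT (fun n s => k s (F n)) xpredT.
  by apply => n *; [exact: measure_ge0|exact: kF].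
Qed.

Lemma giry_bindE d1 d2 (S : measurableType d1) (T : measurableType d2) (R : realType)
    (P : giry S R) (k : S -> giry T R) (mk : measurable_fun setT k) A : measurable A ->
  (giry_bind P mk A = \int[P]_s k s A)%E.
Proof.
move=> mA; transitivity (\int[giry_bind P mk]_t (\1_A t)%:E)%E.
  by rewrite integral_indic// setIT.
rewrite ge0_integral_mixture//; last exact/measurable_EFinP/measurable_indic.
by apply: eq_integral => s _; rewrite integral_indic ?setIT.
Qed.

Lemma measurable_fine_integral_giry d1 d2 (S : measurableType d1) (T : measurableType d2)
    (R : realType) (k : S -> giry T R) (f : T -> R) :
  measurable_fun setT k -> measurable_fun setT f ->
  measurable_fun setT (fun s => fine (\int[k s]_t (f t)%:E)%E).
Proof.
move=> mk mf; apply: measurableT_comp => //.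
have mEf : measurable_fun setT (EFin \o f) by exact/measurable_EFinP.
apply: (eq_measurable_fun (fun s => (\int[k s]_t (EFin \o f)^\+ t -
    \int[k s]_t (EFin \o f)^\- t)%E)).
  by move=> s _; rewrite [RHS]integralE.
apply: emeasurable_funB; apply: (measurable_integral_giry mk) => //.
- exact: measurable_funepos.
- exact: measurable_funeneg.
Qed.

(** * Powers of a random measure and subvectors of the sequence *)

Section tuple_power_theory.
Context d (T : measurableType d) (R : realType).

Lemma tuple_product_box n (mu : 'I_n -> probability T R) (B : 'I_n -> set T) :
  (forall i, measurable (B i)) ->
  tuple_product mu (box B) = (\prod_(i < n) fine (mu i (B i)))%:E.
Proof.
elim: n mu B => [|n IH] mu B mB.
  rewrite big_ord0 /= diracE mem_set//; first by move=> [].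
rewrite big_ord_recl EFinM fineK ?fin_num_measure// -IH//.
rewrite -product_measure1E//; last exact: measurable_box.
rewrite /= /pushforward; congr (_ _).
apply/seteqP; split => -[x t] /=.
  move=> Bxt; split; first exact: (Bxt ord0).
  by move=> i; have := Bxt (lift ord0 i); rewrite tnthS.
by move=> [Bx Bt] i; case: (unliftP ord0 i) => [j ->|->] //; rewrite tnthS; exact: Bt.
Qed.

Lemma measurable_tuple_power d' (S : measurableType d') (k : S -> probability T R) n :
  (forall C, measurable C -> measurable_fun setT (fun s => k s C)) ->
  measurable_fun setT (fun s => tuple_power n (k s) : giry (n.-tuple T) R).
Proof.
move=> mk.
apply: (measurable_giry_generator (@measurable_tuple_boxes _ T n) (@boxes_setI _ T n)).
move=> _ [B mB <-]; rewrite /tuple_power.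
under eq_fun do rewrite tuple_product_box//.
apply/measurable_EFinP/measurable_prod => i _.
by apply: measurableT_comp => //; exact: mk.
Qed.

End tuple_power_theory.

Section sides.
Context d (Omega : measurableType d) (R : realType) (P : probability Omega R).
Context d' (T : measurableType d').
Variable X : nat -> {RV P >-> T}.

(** Index lists are plain sequences, so that they can be concatenated, permuted and shortened
    without transport along equalities of sizes. *)
Definition subvector n (e : seq nat) (w : Omega) : n.-tuple T :=
  [tuple X (nth 0%N e i) w | i < n].

Lemma measurable_subvector n e : measurable_fun setT (subvector n e).
Proof. by apply: measurable_mktuple => i; exact: measurable_funP. Qed.

Definition sides n (B : 'I_n -> set T) := [seq B i | i <- enum 'I_n].
(** A box on the coordinates [e], in the format that the hypotheses on [Q] expect. *)
Definition indexed_sides n (e : seq nat) (B : 'I_n -> set T) :=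
  [seq (nth 0%N e (i : 'I_n), B i) | i <- enum 'I_n].

Lemma map_fst_indexed_sides n e (B : 'I_n -> set T) : size e = n ->
  map fst (indexed_sides e B) = e.
Proof.
move=> en; rewrite /indexed_sides; apply: (@eq_from_nth _ 0%N).
  by rewrite 2!size_map size_enum_ord.
move=> i; rewrite 2!size_map size_enum_ord => ilt.
rewrite -map_comp (nth_map (Ordinal ilt)) ?size_enum_ord//=.
by rewrite nth_enum_ord.
Qed.

Lemma map_snd_indexed_sides n e (B : 'I_n -> set T) : map snd (indexed_sides e B) = sides B.
Proof. by rewrite /indexed_sides -map_comp. Qed.

Lemma measurable_sides n (B : 'I_n -> set T) : (forall i, measurable (B i)) ->
  forall C, C \in sides B -> measurable C.
Proof. by move=> mB C /mapP[i _ ->] /=; exact: mB. Qed.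

Lemma measurable_indexed_sides n e (B : 'I_n -> set T) : (forall i, measurable (B i)) ->
  forall p, p \in indexed_sides e B -> measurable p.2.
Proof. by move=> mB C /mapP[i _ ->] /=; exact: mB. Qed.

Lemma prod_indic_box n (e : seq nat) (B : 'I_n -> set T) w :
  \prod_(p <- indexed_sides e B) \1_(p.2) (X p.1 w) = \1_(box B) (subvector n e w) :> R.
Proof.
rewrite big_map /= big_enum /= indicE.
have [inB|ninB] := boolP (_ \in box B).
  rewrite big1// => i _; rewrite indicE mem_set//.
  by move: inB; rewrite inE => /(_ i); rewrite tnth_mktuple.
suff [i Bi] : exists i, ~ B i (X (nth 0%N e i) w).
  by rewrite (bigD1 i)//= indicE memNset// mul0r.
apply: contrapT => /forallNP h; move/negP: ninB; apply; rewrite inE => i.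
by rewrite tnth_mktuple; apply: contrapT; exact: h.
Qed.

End sides.

(** * Subvectors and integrals given the directing measure *)

Section exchangeable.
Context d (Omega : measurableType d) (R : realType) (P : probability Omega R).
Context d' (T : measurableType d').
Variables (X : nat -> {RV P >-> T}) (D : {RV P >-> pprobability T R}).
Variable Q : seq (set T) -> \bar R.

Let DP w : probability T R := D w.

Hypothesis XDQ : forall (Cs : seq (set T)) (s : seq (nat * set T)),
  uniq (map fst s) -> (forall p, p \in s -> measurable p.2) ->
  (forall C, C \in Cs -> measurable C) ->
  (\int[P]_w (\prod_(p <- s) \1_(p.2) (X p.1 w) *
               \prod_(C <- Cs) fine (DP w C))%:E = Q (map snd s ++ Cs))%E.

Local Notation subvector := (subvector X).
Let msub := measurable_subvector X.

Definition directing_power n (w : Omega) : giry (n.-tuple T) R := tuple_power n (DP w).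

Lemma measurable_directing_power n : measurable_fun setT (@directing_power n).
Proof. by apply: measurable_tuple_power; exact: measurable_directing. Qed.
Let mpow := measurable_directing_power.

Let prod_directing n (B : 'I_n -> set T) w : (forall i, measurable (B i)) ->
  (\prod_(C <- sides B) fine (DP w C))%:E = directing_power n w (box B).
Proof.
by move=> mB; rewrite big_map big_enum /= [RHS]tuple_product_box.
Qed.

Let XDQ0 (Cs : seq (set T)) : (forall C, C \in Cs -> measurable C) ->
  (\int[P]_w (\prod_(C <- Cs) fine (DP w C))%:E = Q Cs)%E.
Proof.
move=> mCs; rewrite -[RHS](@XDQ Cs [::])//.
by apply: eq_integral => w _; rewrite big_nil mul1r.
Qed.

Section pair_laws.
Variables (n m : nat).

Let mpair e e' : measurable_fun setT (fun w => (subvector n e w, subvector m e' w)).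
Proof. by apply: measurable_fun_pair; exact: msub. Qed.

(** Together with [mixed_law] and [power_law], this represents the three kinds of second-order
    moments: between two subvectors, between a subvector and an integral against [D], and between
    two such integrals. *)
Definition pair_law e e' : giry (n.-tuple T * m.-tuple T)%type R := giry_map (@mpair e e') P.

Let mmixed e : measurable_fun setT (fun w =>
  giry_prod (giry_ret (subvector n e w), directing_power m w)
    : giry (n.-tuple T * m.-tuple T)%type R).
Proof.
apply: (measurableT_comp measurable_giry_prod); apply: measurable_fun_pair; last exact: mpow.
exact: (measurableT_comp measurable_giry_ret (@msub n e)).
Qed.

Definition mixed_law e := giry_bind P (@mmixed e).

Let mpower : measurable_fun setT (fun w =>
  giry_prod (directing_power n w, directing_power m w)
    : giry (n.-tuple T * m.-tuple T)%type R).
Proof.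
apply: (measurableT_comp measurable_giry_prod).
by apply: measurable_fun_pair; exact: mpow.
Qed.

Definition power_law := giry_bind P mpower.

Let unique_on_boxes (m1 m2 : giry (n.-tuple T * m.-tuple T)%type R) :
  (forall B C, (forall i, measurable (B i)) -> (forall i, measurable (C i)) ->
     m1 (box B `*` box C) = m2 (box B `*` box C)) ->
  forall S, measurable S -> m1 S = m2 S.
Proof.
move=> m12; apply: (@prod_measure_unique _ _ _ _ _ (boxes T n) (boxes T m)).
- exact: measurable_tuple_boxes.
- exact: boxes_setI.
- exact: boxes_setT.
- exact: measurable_tuple_boxes.
- exact: boxes_setI.
- exact: boxes_setT.
- by rewrite (le_lt_trans sprobability_setT)// ltry.
- by move=> _ _ [B mB <-] [C mC <-]; exact: m12.
Qed.

(** On a product of boxes both sides are integrals computed by [XDQ]. Replacing masses of [D] by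
    indicators of distinct terms does not change the list of sides, and the value depends on that
    list only. *)
Lemma mixed_lawE e : size e = n -> uniq e -> forall S, measurable S ->
  mixed_law e S = power_law S.
Proof.
move=> en ue; apply: unique_on_boxes => B C mB mC.
have mBox := measurable_box mB; have mBoxC := measurable_box mC.
transitivity (Q (sides B ++ sides C)).
  rewrite giry_bindE; last exact: measurableX.
  rewrite -(map_snd_indexed_sides e) -XDQ; last 3 first.
  - by rewrite map_fst_indexed_sides.
  - exact: measurable_indexed_sides.
  - exact: measurable_sides.
  apply: eq_integral => w _; rewrite [LHS]product_measure1E//.
  by rewrite EFinM prod_directing// prod_indic_box.
rewrite giry_bindE; last exact: measurableX.
rewrite -XDQ0; last by move=> E; rewrite mem_cat => /orP[]; exact: measurable_sides.
apply: eq_integral => w _; rewrite [RHS]product_measure1E//.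
by rewrite big_cat EFinM !prod_directing.
Qed.

Lemma pair_lawE e e' : size e = n -> size e' = m -> uniq (e ++ e') ->
  forall S, measurable S -> pair_law e e' S = power_law S.
Proof.
move=> en em uee S mS; have : uniq e by move: uee; rewrite cat_uniq => /andP[].
move=> /(mixed_lawE en) /(_ _ mS) <-; move: S mS.
apply: unique_on_boxes => B C mB mC.
have mBox := measurable_box mB; have mBoxC := measurable_box mC.
transitivity (Q (sides B ++ sides C)); last first.
  rewrite giry_bindE; last exact: measurableX.
  rewrite -(map_snd_indexed_sides e) -XDQ; last 3 first.
  - by rewrite map_fst_indexed_sides//; move: uee; rewrite cat_uniq => /andP[].
  - exact: measurable_indexed_sides.
  - exact: measurable_sides.
  apply: eq_integral => w _; rewrite [RHS]product_measure1E//.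
  by rewrite EFinM prod_directing// prod_indic_box.
rewrite -(map_snd_indexed_sides e) -(map_snd_indexed_sides e') -map_cat
  -(cats0 (map snd (indexed_sides e B ++ indexed_sides e' C))).
rewrite -XDQ//; last 2 first.
- by rewrite map_cat !map_fst_indexed_sides.
- move=> p; rewrite mem_cat => /orP[].
    exact: (measurable_indexed_sides mB).
  exact: (measurable_indexed_sides mC).
transitivity (\int[pair_law e e']_z (\1_(box B `*` box C) z)%:E)%E.
  by rewrite integral_indic ?setIT//; exact: measurableX.
rewrite [LHS]ge0_integral_pushforward//; last first.
  by apply/measurable_EFinP/measurable_indic; exact: measurableX.
apply: eq_integral => w _; rewrite /= big_nil mulr1 big_cat !prod_indic_box.
rewrite !indicE in_setX /=.
by case: (_ \in box B); case: (_ \in box C); rewrite ?(mulr0, mul0r, mulr1).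
Qed.

End pair_laws.

Definition subvector_law n e : giry (n.-tuple T) R := giry_map (@msub n e) P.

Definition directing_law n : giry (n.-tuple T) R := giry_bind P (@mpow n).

(** The case of a pair whose second component is the empty tuple. *)
Lemma subvector_lawE n e : size e = n -> uniq e -> forall S, measurable S ->
  subvector_law n e S = directing_law n S.
Proof.
move=> en ue S mS.
have mST : measurable (S `*` [set: 0.-tuple T]) by exact: measurableX.
transitivity (pair_law n 0 e [::] (S `*` setT)).
  congr (P _); by apply/seteqP; split => w //= [].
rewrite pair_lawE ?cats0// !giry_bindE//; apply: eq_integral => w _.
rewrite [LHS]product_measure1E//.
by rewrite [X in (_ * X)%E](@probability_setT _ _ _ (tuple_power 0 (DP w))) mule1.
Qed.

Lemma ge0_integral_subvector n e (f : n.-tuple T -> \bar R) : size e = n -> uniq e ->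
  measurable_fun setT f -> (forall t, 0 <= f t)%E ->
  (\int[P]_w f (subvector n e w) = \int[directing_law n]_t f t)%E.
Proof.
move=> en ue mf f0; transitivity (\int[subvector_law n e]_t f t)%E.
  apply/esym/(ge0_integral_pushforward (@msub n e) P measurableT mf).
  by move=> y _; exact: f0.
by apply: eq_measure_integral => S mS _; exact: subvector_lawE.
Qed.

Lemma integrable_subvector n e (f : n.-tuple T -> R) : size e = n -> uniq e ->
  measurable_fun setT f ->
  P.-integrable setT (fun w => (f (subvector n e w))%:E) <->
  (directing_law n).-integrable setT (EFin \o f).
Proof.
move=> en ue mf; split=> /integrableP[mf' foo]; apply/integrableP; split.
- exact/measurable_EFinP.
- rewrite -(@ge0_integral_subvector _ e (fun t => `|(f t)%:E|%E))//.
  exact/measurable_EFinP/measurableT_comp.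
- by apply/measurable_EFinP; exact: measurableT_comp (@msub n e).
- rewrite (@ge0_integral_subvector _ e (fun t => `|(f t)%:E|%E))//.
  exact/measurable_EFinP/measurableT_comp.
Qed.

Lemma integral_subvector n e (f : n.-tuple T -> R) : size e = n -> uniq e ->
  measurable_fun setT f ->
  P.-integrable setT (fun w => (f (subvector n e w))%:E) ->
  (\int[P]_w (f (subvector n e w))%:E = \int[directing_law n]_t (f t)%:E)%E.
Proof.
move=> en ue mf intf; transitivity (\int[subvector_law n e]_t (f t)%:E)%E.
  apply/esym/(integral_pushforward (@msub n e)) => //.
  exact/measurable_EFinP.
by apply: eq_measure_integral => S mS _; exact: subvector_lawE.
Qed.

Section kernel_integral.
Variables (n : nat) (h : n.-tuple T -> R).
Hypothesis mh : measurable_fun setT h.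

(** [fine] yields a total real function; it agrees with the integral wherever [h] is integrable for
    the power of [D w], that is almost surely. *)
Definition directing_integral (w : Omega) : R :=
  fine (\int[directing_power n w]_t (h t)%:E).

Hypothesis sqh : sq_integrable P (h \o subvector n (iota 0 n)).

Let usub k : uniq (iota k n). Proof. exact: iota_uniq. Qed.
Let ssub k : size (iota k n) = n. Proof. exact: size_iota. Qed.

Lemma sq_integrable_subvector e : size e = n -> uniq e ->
  sq_integrable P (h \o subvector n e).
Proof.
move=> en ue; split; first exact: measurableT_comp (@msub n e).
case: sqh => _; rewrite (@ge0_integral_subvector _ _ (fun t => (h t ^+ 2)%:E))//; last 2 first.
- exact/measurable_EFinP/measurable_funX.
- by move=> t; rewrite lee_fin sqr_ge0.
rewrite (@ge0_integral_subvector _ _ (fun t => (h t ^+ 2)%:E))//.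
- exact/measurable_EFinP/measurable_funX.
- by move=> t; rewrite lee_fin sqr_ge0.
Qed.

Lemma ae_integrable_directing :
  {ae P, forall w, (directing_power n w).-integrable setT (EFin \o h)}.
Proof.
apply: (@ae_integrable_mixture _ _ _ _ _ P (@directing_power n) (@mpow n)).
apply/(integrable_subvector (ssub 0) (usub 0)) => //.
exact: sq_integrable_integrable.
Qed.

Lemma ae_directing_integralE : {ae P, forall w,
  (directing_integral w)%:E = (\int[directing_power n w]_t (h t)%:E)%E}.
Proof.
apply: filterS ae_integrable_directing => w ih.
by rewrite fineK//; exact: integrable_fin_num.
Qed.

Lemma measurable_directing_integral : measurable_fun setT directing_integral.
Proof. exact: measurable_fine_integral_giry (@mpow n) mh. Qed.

Let F (z : n.-tuple T * n.-tuple T) : \bar R := (h z.1 * h z.2)%:E.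

Let mF : measurable_fun setT F.
Proof. by apply/measurable_EFinP/measurable_funM; exact: measurableT_comp. Qed.

Let eq_integrableF (m1 m2 : giry (n.-tuple T * n.-tuple T)%type R) :
  (forall S, measurable S -> m1 S = m2 S) -> m1.-integrable setT F -> m2.-integrable setT F.
Proof.
move=> m12 /integrableP[_ Foo]; apply/integrableP; split => //.
apply: le_lt_trans Foo; rewrite le_eqVlt; apply/orP; left; apply/eqP.
by apply: eq_measure_integral => S mS _; exact/esym/m12.
Qed.

Let int_pair e e' : size e = n -> size e' = n -> uniq (e ++ e') ->
  (pair_law n n e e').-integrable setT F.
Proof.
move=> en en'; rewrite cat_uniq => /and3P[ue _ ue'].
apply: integrable_pushforward => //.
  by apply: measurable_fun_pair; exact: msub.
by apply: (sq_integrableM (sq_integrable_subvector en ue) (sq_integrable_subvector en' ue')).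
Qed.

Let u2 : uniq (iota 0 n ++ iota n n).
Proof. by rewrite -iotaD iota_uniq. Qed.

Let int_power : (power_law n n).-integrable setT F.
Proof.
apply: eq_integrableF (int_pair (ssub 0) (ssub n) u2).
exact: pair_lawE.
Qed.

Let ae_power : {ae P, forall w, setT w ->
  (\int[giry_prod (directing_power n w, directing_power n w)]_z F z)%E =
  (directing_integral w ^+ 2)%:E}.
Proof.
apply: filterS ae_integrable_directing => w ih _.
rewrite [LHS](integral_tensor ih ih) -[X in (X * _)%E](fineK (integrable_fin_num measurableT ih)).
by rewrite -[X in (_ * X)%E](fineK (integrable_fin_num measurableT ih)) -EFinM -expr2.
Qed.

Let mI2 : measurable_fun setT (fun w => (directing_integral w ^+ 2)%:E).
Proof. exact/measurable_EFinP/measurable_funX/measurable_directing_integral. Qed.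

(** The square of the integral is almost surely the integral of the product kernel, whose mixture is
    the joint law of two disjoint subvectors. There the kernel is integrable, as a product of two
    square-integrable variables. *)
Lemma sq_integrable_directing : sq_integrable P directing_integral.
Proof.
apply/sq_integrableP; split; first exact: measurable_directing_integral.
have ipow := integrable_mixture int_power.
have /integrableP[_ Foo] := ipow.
apply/integrableP; split => //.
apply: le_lt_trans Foo; rewrite le_eqVlt; apply/orP; left; apply/eqP.
apply: ge0_ae_eq_integral => //.
- exact: measurableT_comp.
- by apply: measurableT_comp => //; exact: measurable_int ipow.
- by apply: filterS ae_power => w /(_ I) -> _.
Qed.

Let integral_power :
  (\int[power_law n n]_z F z = \int[P]_w (directing_integral w ^+ 2)%:E)%E.
Proof.
rewrite integral_mixture; last exact: int_power.
apply: ae_eq_integral => //.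
exact: measurable_int (integrable_mixture int_power).
Qed.

Lemma integral_pair e e' : size e = n -> size e' = n -> uniq (e ++ e') ->
  (\int[P]_w (h (subvector n e w) * h (subvector n e' w))%:E =
   \int[P]_w (directing_integral w ^+ 2)%:E)%E.
Proof.
move=> en en' uee; rewrite -integral_power.
transitivity (\int[pair_law n n e e']_z F z)%E.
  apply/esym/(integral_pushforward (measurable_fun_pair (@msub n e) (@msub n e'))) => //.
  have := uee; rewrite cat_uniq => /and3P[ue _ ue'].
  exact: (sq_integrableM (sq_integrable_subvector en ue) (sq_integrable_subvector en' ue')).
by apply: eq_measure_integral => S mS _; exact: pair_lawE.
Qed.

(** In other words, the deviation of [h (subvector n e w)] from the integral is orthogonal to the
    integral. *)
Lemma integral_mixed e : size e = n -> uniq e ->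
  (\int[P]_w (h (subvector n e w) * directing_integral w)%:E =
   \int[P]_w (directing_integral w ^+ 2)%:E)%E.
Proof.
move=> en ue; rewrite -integral_power.
have int_mixed : (mixed_law n n e).-integrable setT F.
  by apply: eq_integrableF int_power => S mS; apply/esym; exact: mixed_lawE.
transitivity (\int[mixed_law n n e]_z F z)%E; last first.
  by apply: eq_measure_integral => S mS _; exact: mixed_lawE.
rewrite [RHS]integral_mixture; last exact: int_mixed.
apply: ae_eq_integral => //.
- apply/measurable_EFinP/measurable_funM; last exact: measurable_directing_integral.
  exact: measurableT_comp (@msub n e).
- exact: measurable_int (integrable_mixture int_mixed).
apply: filterS ae_integrable_directing => w ih _.
have iret : (giry_ret (subvector n e w) : giry (n.-tuple T) R).-integrable setT (EFin \o h).
  apply/integrableP; split; first exact/measurable_EFinP.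
  rewrite integral_dirac//; last exact/measurable_EFinP/measurableT_comp.
  by rewrite diracT mul1e ltry.
rewrite [RHS](integral_tensor iret ih) EFinM; congr (_ * _)%E.
  by rewrite integral_dirac// ?diracT ?mul1e//; exact/measurable_EFinP.
by rewrite fineK//; exact: integrable_fin_num ih.
Qed.

End kernel_integral.
End exchangeable.

(** * Degenerate kernels *)

Section predictive.
Context d (Omega : measurableType d) (R : realType) (P : probability Omega R).
Context d' (T : measurableType d').
Variables (X : nat -> {RV P >-> T}) (Q : seq (set T) -> \bar R).
Variables (alpha : {finite_measure set T -> \bar R}) (theta : R).
Hypothesis theta_gt0 : 0 < theta.

Hypothesis XQ : forall s : seq (nat * set T), uniq (map fst s) ->
  (forall p, p \in s -> measurable p.2) ->
  (\int[P]_w (\prod_(p <- s) \1_(p.2) (X p.1 w))%:E = Q (map snd s))%E.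

Hypothesis Q_perm : forall Cs Cs' : seq (set T), (forall C, C \in Cs -> measurable C) ->
  perm_eq Cs Cs' -> Q Cs = Q Cs'.

Hypothesis Q_rcons : forall (Bs : seq (set T)) (C : set T),
  (forall B, B \in Bs -> measurable B) -> measurable C ->
  ((theta + (size Bs)%:R)%:E * Q (rcons Bs C) =
   alpha C * Q Bs + \sum_(l < size Bs) Q (set_nth setT Bs l (nth setT Bs l `&` C)))%E.

Local Notation subvector := (subvector X).

Let mjoint n i e : measurable_fun setT (fun w => (X i w, subvector n e w)).
Proof.
by apply: measurable_fun_pair; [exact: measurable_funP|exact: measurable_subvector].
Qed.

Definition joint_law n i e : giry (T * n.-tuple T)%type R := giry_map (@mjoint n i e) P.

Let law n e : giry (n.-tuple T) R := giry_map (measurable_subvector X e) P.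

Let lawQ n e (B : 'I_n -> set T) : size e = n -> uniq e -> (forall i, measurable (B i)) ->
  law n e (box B) = Q (sides B).
Proof.
move=> en ue mB; have mBox := measurable_box mB.
rewrite -(map_snd_indexed_sides e) -XQ; last 2 first.
- by rewrite map_fst_indexed_sides.
- exact: measurable_indexed_sides.
transitivity (\int[law n e]_t (\1_(box B) t)%:E)%E; first by rewrite integral_indic ?setIT.
rewrite [LHS]ge0_integral_pushforward//; last 2 first.
- exact: measurable_subvector.
- by apply/measurable_EFinP/measurable_indic.
by apply: eq_integral => w _; rewrite prod_indic_box.
Qed.

Let joint_new n i e (B : 'I_n -> set T) C : size e = n -> uniq (i :: e) ->
  (forall i, measurable (B i)) -> measurable C ->
  joint_law n i e (C `*` box B) = Q (C :: sides B).
Proof.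
move=> en uie mB mC; have mBox := measurable_box mB.
rewrite -(map_snd_indexed_sides e).
rewrite -[_ :: _]/(map snd ((i, C) :: indexed_sides e B)) -XQ; last 2 first.
- by rewrite /= map_fst_indexed_sides.
- by move=> p; rewrite inE => /predU1P[->//|]; exact: measurable_indexed_sides.
transitivity (\int[joint_law n i e]_t (\1_(C `*` box B) t)%:E)%E.
  by rewrite integral_indic ?setIT//; exact: measurableX.
rewrite [LHS]ge0_integral_pushforward//; last 2 first.
- exact: mjoint.
- by apply/measurable_EFinP/measurable_indic; exact: measurableX.
apply: eq_integral => w _; rewrite big_cons prod_indic_box /= !indicE in_setX /=.
by case: (_ \in C); case: (_ \in box B); rewrite ?(mulr0, mul0r, mulr1).
Qed.

(** A repeated variable imposes one more constraint on coordinate [l], whose side becomes its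
    intersection with [C]. *)
Let joint_old n e (l : 'I_n) (B : 'I_n -> set T) C : size e = n -> uniq e ->
  (forall i, measurable (B i)) -> measurable C ->
  joint_law n (nth 0%N e l) e (C `*` box B) =
  Q (set_nth setT (sides B) l (nth setT (sides B) l `&` C)).
Proof.
move=> en ue mB mC.
pose B' i := if i == l then B i `&` C else B i.
have -> : set_nth setT (sides B) l (nth setT (sides B) l `&` C) = sides B'.
  have szB (E : 'I_n -> set T) : size (sides E) = n by rewrite size_map size_enum_ord.
  have nthB (E : 'I_n -> set T) (k : 'I_n) : nth setT (sides E) k = E k.
    by rewrite (nth_map k) ?size_enum_ord// nth_ord_enum.
  apply: (@eq_from_nth _ setT).
    by rewrite size_set_nth !szB; apply/maxn_idPr.
  move=> k; rewrite size_set_nth szB (maxn_idPr (ltn_ord l)) => kn.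
  rewrite nth_set_nth /= -[k]/(nat_of_ord (Ordinal kn)) !nthB /B'.
  by rewrite -val_eqE; case: eqP => // kl; congr (B _ `&` _); exact/val_inj.
rewrite -(lawQ (e := e))//; last by move=> i; rewrite /B'; case: ifP => // _; exact: measurableI.
congr (P _); apply/seteqP; split => w /=.
  move=> [Cw Bw] i; have := Bw i; rewrite /B' !tnth_mktuple.
  by case: eqP => // ->.
move=> Bw; split; first by have := Bw l; rewrite /B' eqxx tnth_mktuple => -[].
by move=> i; have := Bw i; rewrite /B'; case: eqP => // _ [].
Qed.

Let size_gt0 n : 0 < theta + n%:R.
Proof. by rewrite ltr_wpDr. Qed.

Let urn_law n e : {measure set (T * n.-tuple T) -> \bar R} :=
  measure_add (alpha \x law n e)%E (msum (fun l => joint_law n (nth 0%N e l) e) n).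

(** The urn rule as an identity of measures. On boxes it is [Q_rcons], once symmetry has moved the
    side of the new variable from the front to the end. *)
Let predictive_law n i e : size e = n -> uniq (i :: e) -> forall S, measurable S ->
  mscale (NngNum (ltW (size_gt0 n))) (joint_law n i e) S = urn_law n e S.
Proof.
move=> en uie; have ue : uniq e by case/andP: uie.
apply: (@prod_measure_unique _ _ _ _ _ measurable (boxes T n)).
- by rewrite sigma_algebra_id//; exact: sigma_algebra_measurable.
- by move=> A B; exact: measurableI.
- exact: measurableT.
- exact: measurable_tuple_boxes.
- exact: boxes_setI.
- exact: boxes_setT.
- rewrite /mscale/= lte_mul_pinfty//.
  by rewrite (le_lt_trans sprobability_setT)// ltry.
move=> C _ mC [B mB <-]; have mBox := measurable_box mB.
transitivity ((alpha \x law n e) (C `*` box B) +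
    \sum_(l < n) joint_law n (nth 0%N e l) e (C `*` box B))%E; last first.
  by apply/esym; exact: measure_addE.
rewrite product_measure1E//.
transitivity ((theta + n%:R)%:E * joint_law n i e (C `*` box B))%E; first by [].
have -> : joint_law n i e (C `*` box B) = Q (rcons (sides B) C).
  rewrite joint_new//; apply: Q_perm; last by rewrite perm_sym perm_rcons.
  by move=> E; rewrite inE => /predU1P[->//|]; exact: measurable_sides.
have := Q_rcons (measurable_sides mB) mC.
rewrite size_map size_enum_ord => ->.
congr (_ * _ + _)%E; first exact/esym/lawQ.
by apply: eq_bigr => l _; exact/esym/joint_old.
Qed.

Section signed.
Variables (n i : nat) (e : seq nat) (F : T * n.-tuple T -> R).
Hypotheses (en : size e = n) (uie : uniq (i :: e)) (mF : measurable_fun setT F).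
Hypothesis intF : P.-integrable setT (fun w => (F (X i w, subvector n e w))%:E).

Let mEF : measurable_fun setT (EFin \o F). Proof. exact/measurable_EFinP. Qed.

Let ge0_predictive (f : T * n.-tuple T -> \bar R) : measurable_fun setT f ->
  (forall z, 0 <= f z)%E ->
  ((theta + n%:R)%:E * \int[P]_w f (X i w, subvector n e w) =
   \int[alpha \x law n e]_z f z +
   \sum_(l < n) \int[P]_w f (X (nth 0%N e l) w, subvector n e w))%E.
Proof.
move=> mf f0.
have joint_int k : (\int[joint_law n k e]_z f z = \int[P]_w f (X k w, subvector n e w))%E.
  by apply: (ge0_integral_pushforward (@mjoint n k e) P measurableT mf) => z _; exact: f0.
transitivity (\int[mscale (NngNum (ltW (size_gt0 n))) (joint_law n i e)]_z f z)%E.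
  by rewrite ge0_integral_mscale// joint_int.
transitivity (\int[urn_law n e]_z f z)%E.
  by apply: eq_measure_integral => S mS _; exact: predictive_law.
rewrite ge0_integral_measure_add//; congr (_ + _)%E.
rewrite ge0_integral_measure_sum//.
by apply: eq_bigr => l _; exact: joint_int.
Qed.

Let abs_lty : ((theta + n%:R)%:E *
  \int[P]_w `|(F (X i w, subvector n e w))%:E| < +oo)%E.
Proof.
have /integrableP[_ Foo] := intF.
by rewrite lte_mul_pinfty// lee_fin ltW.
Qed.

(** In the urn rule for [|F|] all terms are nonnegative and their sum is finite, so each of them is
    finite. This has to precede the signed identity, where the rules for the two parts are
    subtracted. *)
Lemma integrable_predictive_urn : (alpha \x law n e)%E.-integrable setT (EFin \o F).
Proof.
apply/integrableP; split => //; apply: le_lt_trans abs_lty.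
rewrite (ge0_predictive (f := fun z => `|(F z)%:E|%E))//; last exact: measurableT_comp.
by rewrite leeDl// sume_ge0// => l _; exact: integral_ge0.
Qed.

Lemma integrable_predictive_past (l : 'I_n) :
  P.-integrable setT (fun w => (F (X (nth 0%N e l) w, subvector n e w))%:E).
Proof.
apply/integrableP; split; first exact: (measurableT_comp mEF (@mjoint n _ e)).
apply: le_lt_trans abs_lty.
rewrite (ge0_predictive (f := fun z => `|(F z)%:E|%E))//; last exact: measurableT_comp.
rewrite (bigD1 l)// addeCA leeDl//; apply: adde_ge0; first exact: integral_ge0.
by apply: sume_ge0 => k _; exact: integral_ge0.
Qed.

Lemma predictive :
  ((theta + n%:R)%:E * \int[P]_w (F (X i w, subvector n e w))%:E =
   \int[alpha \x law n e]_z (F z)%:E +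
   \sum_(l < n) \int[P]_w (F (X (nth 0%N e l) w, subvector n e w))%:E)%E.
Proof.
pose J k f := (\int[P]_w f (X k w, subvector n e w))%E.
pose U f := (\int[alpha \x law n e]_z f z)%E.
pose Fp := (EFin \o F)^\+%E; pose Fn := (EFin \o F)^\-%E.
have JE k : P.-integrable setT (fun w => (F (X k w, subvector n e w))%:E) ->
    [/\ J k (EFin \o F) = (J k Fp - J k Fn)%E, J k Fp \is a fin_num & J k Fn \is a fin_num].
  move=> ik; have ipos := integrable_funepos measurableT ik.
  have ineg := integrable_funeneg measurableT ik.
  pose g w := (X k w, subvector n e w).
  have ipos' : P.-integrable setT (Fp \o g) by rewrite -funepos_comp.
  have ineg' : P.-integrable setT (Fn \o g) by rewrite -funeneg_comp.
  split.
  - rewrite /J [LHS]integralE; congr (_ - _)%E; apply: eq_integral => w _.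
      by rewrite -[LHS]/(((EFin \o F) \o g)^\+%E w) funepos_comp.
    by rewrite -[LHS]/(((EFin \o F) \o g)^\-%E w) funeneg_comp.
  - exact: (integrable_fin_num measurableT ipos').
  - exact: (integrable_fin_num measurableT ineg').
have [Ji Jip Jin] := JE _ intF.
have UE : U (EFin \o F) = (U Fp - U Fn)%E by rewrite /U integralE.
have Up : U Fp \is a fin_num.
  exact: (integrable_fin_num measurableT
    (integrable_funepos measurableT integrable_predictive_urn)).
have Un : U Fn \is a fin_num.
  exact: (integrable_fin_num measurableT
    (integrable_funeneg measurableT integrable_predictive_urn)).
have hp : ((theta + n%:R)%:E * J i Fp = U Fp + \sum_(l < n) J (nth 0%N e l) Fp)%E.
  by apply: ge0_predictive => [|z]; [exact: measurable_funepos|rewrite funepos_ge0].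
have hn : ((theta + n%:R)%:E * J i Fn = U Fn + \sum_(l < n) J (nth 0%N e l) Fn)%E.
  by apply: ge0_predictive => [|z]; [exact: measurable_funeneg|rewrite funeneg_ge0].
have Jl (l : 'I_n) := JE _ (integrable_predictive_past l).
suff : ((theta + n%:R)%:E * J i (EFin \o F) =
    U (EFin \o F) + \sum_(l < n) J (nth 0%N e l) (EFin \o F))%E by [].
have sumJ f : (forall l : 'I_n, J (nth 0%N e l) f \is a fin_num) ->
    (\sum_(l < n) J (nth 0%N e l) f = (\sum_(l < n) fine (J (nth 0%N e l) f))%:E)%E.
  by move=> ffin; rewrite -sumEFin; apply: eq_bigr => l _; rewrite fineK.
rewrite sumJ in hp; last by move=> l; have [] := Jl l.
rewrite sumJ in hn; last by move=> l; have [] := Jl l.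
rewrite sumJ; last by move=> l; have [-> ? ?] := Jl l; rewrite fin_numB; apply/andP.
rewrite Ji UE.
move: hp hn; rewrite -(fineK Jip) -(fineK Jin) -(fineK Up) -(fineK Un).
rewrite -!EFinB -!EFinM -!EFinD => -[hp] [hn]; congr EFin.
rewrite mulrBr hp hn.
under [in RHS]eq_bigr => l _.
  have [-> Jlp Jln] := Jl l; rewrite fineB//; over.
by rewrite sumrB; ring.
Qed.

End signed.
End predictive.

(** * Second moments of degenerate kernels *)

Section degenerate.
Context d (Omega : measurableType d) (R : realType) (P : probability Omega R).
Context d' (T : measurableType d').
Variables (X : nat -> {RV P >-> T}) (D : {RV P >-> pprobability T R}).
Variables (Q : seq (set T) -> \bar R).
Variables (alpha : {finite_measure set T -> \bar R}) (theta : R).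
Hypothesis theta_gt0 : 0 < theta.

Hypothesis XDQ : forall (Cs : seq (set T)) (s : seq (nat * set T)),
  uniq (map fst s) -> (forall p, p \in s -> measurable p.2) ->
  (forall C, C \in Cs -> measurable C) ->
  (\int[P]_w (\prod_(p <- s) \1_(p.2) (X p.1 w) *
               \prod_(C <- Cs) fine ((D w : probability T R) C))%:E =
   Q (map snd s ++ Cs))%E.

Hypothesis Q_perm : forall Cs Cs' : seq (set T), (forall C, C \in Cs -> measurable C) ->
  perm_eq Cs Cs' -> Q Cs = Q Cs'.

Hypothesis Q_rcons : forall (Bs : seq (set T)) (C : set T),
  (forall B, B \in Bs -> measurable B) -> measurable C ->
  ((theta + (size Bs)%:R)%:E * Q (rcons Bs C) =
   alpha C * Q Bs + \sum_(l < size Bs) Q (set_nth setT Bs l (nth setT Bs l `&` C)))%E.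

Local Notation subvector := (subvector X).

Let XQ (s : seq (nat * set T)) : uniq (map fst s) ->
  (forall p, p \in s -> measurable p.2) ->
  (\int[P]_w (\prod_(p <- s) \1_(p.2) (X p.1 w))%:E = Q (map snd s))%E.
Proof.
move=> us ms; rewrite -[map snd s]cats0 -XDQ//.
by apply: eq_integral => w _; rewrite big_nil mulr1.
Qed.

Lemma subvector_cons m i s w :
  subvector m.+1 (i :: s) w = [the m.+1.-tuple T of X i w :: subvector m s w].
Proof.
apply: eq_from_tnth => j; rewrite tnth_mktuple.
by case: (unliftP ord0 j) => [k ->|->] //=; rewrite tnthS tnth_mktuple.
Qed.

(** A symmetric kernel sees only the set of indices, so index lists may be rearranged freely from
    here on. *)
Lemma subvector_perm n (h : n.-tuple T -> R) e e' w :
  (forall (s : 'S_n) t, h [tuple tnth t (s i) | i < n] = h t) ->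
  size e = n -> perm_eq e e' -> h (subvector n e w) = h (subvector n e' w).
Proof.
move=> symh en ee'; have en' : size e' == n by rewrite -(perm_size ee') en.
have /tuple_permP[p ep] : perm_eq e (Tuple en') by [].
rewrite -[RHS](symh p); congr h; apply: eq_from_tnth => i; rewrite !tnth_mktuple.
by rewrite ep -(tnth_nth _ [tuple _ | _ < _]) tnth_mktuple (tnth_nth 0%N).
Qed.

Variables (m : nat) (h : m.+1.-tuple T -> R).
Hypothesis mh : measurable_fun setT h.
Hypothesis symh : forall (s : 'S_m.+1) t, h [tuple tnth t (s i) | i < m.+1] = h t.
Hypothesis sqh : sq_integrable P (h \o subvector m.+1 (iota 0 m.+1)).
Hypothesis degh : forall S : set (m.-tuple T), measurable S ->
  (\int[P]_(w in subvector m (iota 0 m) @^-1` S) (h (subvector m.+1 (iota 0 m.+1) w))%:E = 0)%E.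

Let sq_sub e (en : size e = m.+1) (ue : uniq e) : sq_integrable P (h \o subvector m.+1 e) :=
  sq_integrable_subvector XDQ mh sqh en ue.

Let hc (x : T) (y : m.-tuple T) := h [the m.+1.-tuple T of x :: y].

Let hcE i s w : hc (X i w) (subvector m s w) = h (subvector m.+1 (i :: s) w).
Proof. by rewrite subvector_cons. Qed.

Let urn_mean (y : m.-tuple T) : R := fine (\int[alpha]_x (hc x y)%:E)%E.

Section urn_tensor.
Variables (n i : nat) (e s : seq nat).
Hypotheses (en : size e = n) (uie : uniq (i :: e)) (sm : size s = m) (uis : uniq (i :: s)).
Variable r : n.-tuple T -> m.-tuple T.
Hypotheses (mr : measurable_fun setT r) (rE : forall w, r (subvector n e w) = subvector m s w).
Variable G : n.-tuple T -> R.
Hypothesis mG : measurable_fun setT G.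
Hypothesis iG : P.-integrable setT
  (fun w => (G (subvector n e w) * h (subvector m.+1 (i :: s) w))%:E).

Let law : giry (n.-tuple T) R := giry_map (measurable_subvector X e) P.

Let mhr : measurable_fun setT (fun z : T * n.-tuple T => hc z.1 (r z.2)).
Proof.
apply: (measurableT_comp mh); apply: measurable_cons => //.
exact: measurableT_comp.
Qed.

(** [r] recovers [X_s] from the longer vector [X_e], so the factor [G] may depend on variables that
    do not enter [h]. *)
Let F (z : T * n.-tuple T) := G z.2 * hc z.1 (r z.2).

Let mF : measurable_fun setT F.
Proof. by apply: measurable_funM => //; exact: measurableT_comp. Qed.

Let ihr : P.-integrable setT (fun w => (hc (X i w) (r (subvector n e w)))%:E).
Proof.
have /sq_integrable_integrable : sq_integrable P (h \o subvector m.+1 (i :: s)).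
  by apply: sq_sub => //=; rewrite sm.
by apply: eq_integrable => // w _; rewrite rE hcE.
Qed.

Let iF : P.-integrable setT (fun w => (F (X i w, subvector n e w))%:E).
Proof. by apply: eq_integrable iG => // w _; rewrite /F /= rE hcE. Qed.

Let urnF := integrable_predictive_urn theta_gt0 XQ Q_perm Q_rcons en uie mF iF.
Let urnhr := integrable_predictive_urn theta_gt0 XQ Q_perm Q_rcons en uie mhr ihr.

Lemma integrable_predictive_term (l : 'I_n) : P.-integrable setT
  (fun w => (G (subvector n e w) * h (subvector m.+1 (nth 0%N e l :: s) w))%:E).
Proof.
have := integrable_predictive_past theta_gt0 XQ Q_perm Q_rcons en uie mF iF l.
by apply: eq_integrable => // w _; rewrite /F /= rE hcE.
Qed.

Let ae_G : {ae law, forall y, setT y ->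
  (\int[alpha]_x (F (x, y))%:E = (G y * urn_mean (r y))%:E)%E}.
Proof.
have := ae_integrable2 urnhr; apply: filterS => y iy _; rewrite /F /=.
under eq_integral do rewrite EFinM.
by rewrite integralZl// -(fineK (integrable_fin_num measurableT iy)).
Qed.

Lemma measurable_urn_mean : measurable_fun setT (fun y => urn_mean (r y)).
Proof.
rewrite [X in measurable_fun _ X](_ : _ = fine \o
  fubini_G alpha (EFin \o fun z : T * n.-tuple T => hc z.1 (r z.2)))//.
by apply: measurableT_comp => //; exact: (measurable_fubini_G urnhr).
Qed.

Let int_law : law.-integrable setT (fun y => (G y * urn_mean (r y))%:E).
Proof.
have mGu : measurable_fun setT (fun y => (G y * urn_mean (r y))%:E).
  by apply/measurable_EFinP/measurable_funM => //; exact: measurable_urn_mean.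
apply/integrableP; split => //.
have := (integrable21ltyP alpha law (measurable_int _ urnF)).1 urnF.
apply: le_lt_trans.
rewrite -(ge0_ae_eq_integral (f := fun y => `|\int[alpha]_x (F (x, y))%:E|%E))//; last 3 first.
- by apply: measurableT_comp => //; exact: (measurable_fubini_G urnF).
- exact: measurableT_comp.
- by apply: filterS ae_G => y /(_ I) -> _.
apply: ge0_le_integral => //.
- by apply: measurableT_comp => //; exact: (measurable_fubini_G urnF).
- apply: (measurable_fun_fubini_tonelli_G (fun z => `|(F z)%:E|%E)) => //.
  exact/measurable_EFinP/measurableT_comp.
move=> y _; apply: le_abse_integral => //.
exact/measurable_EFinP/(measurableT_comp mF (measurable_pair2 y)).
Qed.

Lemma integrable_urn_mean :
  P.-integrable setT (fun w => (G (subvector n e w) * urn_mean (subvector m s w))%:E).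
Proof.
pose f y : \bar R := (G y * urn_mean (r y))%:E.
have /integrableP[mf foo] : law.-integrable setT f by exact: int_law.
have : P.-integrable setT (f \o subvector n e).
  apply/integrableP; split; first exact: measurableT_comp (measurable_subvector X e).
  apply: le_lt_trans foo; rewrite le_eqVlt; apply/orP; left; apply/eqP.
  apply/esym; apply: (ge0_integral_pushforward (measurable_subvector X e) P measurableT) => //.
  exact: measurableT_comp.
by apply: eq_integrable => // w _; rewrite /f /= rE.
Qed.

(** A ball of the initial urn is independent of the past: its contribution is an integral for a
    product measure, and Fubini integrates the ball out into [urn_mean]. *)
Lemma predictive_tensor :
  ((theta + n%:R)%:E *
     \int[P]_w (G (subvector n e w) * h (subvector m.+1 (i :: s) w))%:E =
   \int[P]_w (G (subvector n e w) * urn_mean (subvector m s w))%:E +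
   \sum_(l < n) \int[P]_w
      (G (subvector n e w) * h (subvector m.+1 (nth 0%N e l :: s) w))%:E)%E.
Proof.
have := predictive theta_gt0 XQ Q_perm Q_rcons en uie mF iF.
under eq_integral do rewrite /F /= rE hcE.
move=> ->; congr (_ + _)%E; last first.
  by apply: eq_bigr => l _; apply: eq_integral => w _; rewrite /F /= rE hcE.
have E : (\int[alpha \x law]_z (F z)%:E = \int[law]_y (G y * urn_mean (r y))%:E)%E.
  rewrite -[LHS](integral21_prod_meas1 urnF).
  apply: ae_eq_integral => //; first exact: (measurable_fubini_G urnF).
  exact: measurable_int int_law.
apply: (eq_trans E).
transitivity (\int[P]_w (G (subvector n e w) * urn_mean (r (subvector n e w)))%:E)%E.
  apply: (integral_pushforward (measurable_subvector X e) (mu := P)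
    (f := fun y => (G y * urn_mean (r y))%:E)) => //.
    exact: measurable_int int_law.
  by apply: eq_integrable integrable_urn_mean => // w _; rewrite /= rE.
by apply: eq_integral => w _; rewrite rE.
Qed.

End urn_tensor.
Let integrable_indic_h (S : set (m.-tuple T)) i s : measurable S -> size s = m ->
  uniq (i :: s) -> P.-integrable setT
    (fun w => (\1_S (subvector m s w) * h (subvector m.+1 (i :: s) w))%:E).
Proof.
move=> mS sm uis; apply: sq_integrableM; last first.
  by apply: sq_sub => //=; rewrite sm.
apply/sq_integrableP; split.
  by apply: (measurableT_comp (measurable_indic mS)); exact: measurable_subvector.
apply: measurable_unit_integrable.
  apply: measurable_funX.
  by apply: (measurableT_comp (measurable_indic mS)); exact: measurable_subvector.
by move=> w; rewrite indicE; case: (_ \in _); rewrite ?expr0n ?expr1n ?lexx ?ler01.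
Qed.

(** Degeneracy is assumed for the initial indices, with the additional variable in last position.
    The common law of subvectors carries it to any distinct indices, and the symmetry of [h] lets
    the additional variable stand in front. *)
Let degenerate_indic (S : set (m.-tuple T)) i s : measurable S -> size s = m ->
  uniq (i :: s) ->
  (\int[P]_w (\1_S (subvector m s w) * h (subvector m.+1 (i :: s) w))%:E = 0)%E.
Proof.
move=> mS sm uis.
pose f (t : m.+1.-tuple T) : R := \1_S [tuple of behead t] * h t.
have mf : measurable_fun setT f.
  apply: measurable_funM => //; apply: (measurableT_comp (measurable_indic mS)).
  exact: measurable_behead.
have fE j u w : f (subvector m.+1 (j :: u) w) =
    \1_S (subvector m u w) * h (subvector m.+1 (j :: u) w).
  rewrite /f subvector_cons; congr (\1_S _ * _).
  exact/val_inj.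
have um : uniq (m :: iota 0 m) by rewrite /= mem_iota ltnn iota_uniq.
transitivity (\int[directing_law D m.+1]_t (f t)%:E)%E.
  rewrite -(integral_subvector XDQ (e := i :: s))//=.
  - by apply: eq_integral => w _; rewrite fE.
  - by rewrite sm.
  - by apply: eq_integrable (integrable_indic_h mS sm uis) => // w _; rewrite fE.
rewrite -(integral_subvector XDQ (e := m :: iota 0 m))//=; last 2 first.
- by rewrite size_iota.
- have := integrable_indic_h mS (size_iota 0 m) um.
  by apply: eq_integrable => // w _; rewrite fE.
rewrite -[RHS](degh mS) [RHS]integral_mkcond; apply: eq_integral => w _.
rewrite epatch_indic fE EFinM muleC; congr (_ * _)%E.
congr EFin; apply: subvector_perm => //; first by rewrite /= size_iota.
by rewrite -addn1 iotaD /= add0n cats1 perm_sym perm_rcons.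
Qed.

(** By the urn rule this is [theta + m] times the conditional mean of [h(X_i, X_s)] given [X_s = y],
    for a new index [i]. *)
Let kappa (y : m.-tuple T) : R := urn_mean y + \sum_(l < m) hc (tnth y l) y.

Let kappaE s w : kappa (subvector m s w) = urn_mean (subvector m s w) +
  \sum_(l < m) h (subvector m.+1 (nth 0%N s l :: s) w).
Proof. by congr (_ + _); apply: eq_bigr => l _; rewrite tnth_mktuple hcE. Qed.

(** Since [s] is an initial segment of [e], the copies of entries of [X_s] join the urn mean to form
    [kappa]; copies of the other entries of [X_e] remain as separate terms. *)
Let integral_kappa n i e s (r : n.-tuple T -> m.-tuple T) (G : n.-tuple T -> R) : 
  size e = n -> uniq (i :: e) -> size s = m -> uniq (i :: s) -> 
  measurable_fun setT r -> (forall w, r (subvector n e w) = subvector m s w) ->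
  measurable_fun setT G ->
  P.-integrable setT
    (fun w => (G (subvector n e w) * h (subvector m.+1 (i :: s) w))%:E) ->
  (forall l, (l < m)%N -> nth 0%N s l = nth 0%N e l) -> (m <= n)%N ->
  P.-integrable setT (fun w => (G (subvector n e w) * kappa (subvector m s w))%:E) /\
  ((theta + n%:R)%:E *
     \int[P]_w (G (subvector n e w) * h (subvector m.+1 (i :: s) w))%:E =
   \int[P]_w (G (subvector n e w) * kappa (subvector m s w))%:E +
   \sum_(m <= l < n) \int[P]_w
      (G (subvector n e w) * h (subvector m.+1 (nth 0%N e l :: s) w))%:E)%E.
Proof.
move=> en uie sm uis mr rE mG iG nths mn.
have iterm l : (l < n)%N -> P.-integrable setT
    (fun w => (G (subvector n e w) * h (subvector m.+1 (nth 0%N e l :: s) w))%:E).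
  by move=> ln; exact: (integrable_predictive_term en uie mr rE mG iG (Ordinal ln)).
have iurn := integrable_urn_mean en uie sm uis mr rE mG iG.
have iterms (l : 'I_m) : P.-integrable setT
    (fun w => (G (subvector n e w) * h (subvector m.+1 (nth 0%N s l :: s) w))%:E).
  by rewrite nths//; apply: iterm; rewrite (leq_trans _ mn).
have isum : P.-integrable setT (fun w => \sum_(l < m)
    (G (subvector n e w) * h (subvector m.+1 (nth 0%N s l :: s) w))%:E)%E.
  by apply: integrable_sum => // l _; exact: iterms.
have kE w : ((G (subvector n e w) * kappa (subvector m s w))%:E =
    (G (subvector n e w) * urn_mean (subvector m s w))%:E +
    \sum_(l < m) (G (subvector n e w) * h (subvector m.+1 (nth 0%N s l :: s) w))%:E)%E.
  by rewrite kappaE mulrDr mulr_sumr EFinD -sumEFin.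
split.
  by apply: eq_integrable (integrableD measurableT iurn isum) => // w _; rewrite kE.
rewrite (predictive_tensor en uie sm uis mr rE mG iG).
under [in RHS]eq_integral do rewrite kE.
rewrite integralD// integral_sum//.
rewrite -addeA; congr (_ + _)%E.
rewrite -(big_mkord xpredT (fun l => \int[P]_w
  (G (subvector n e w) * h (subvector m.+1 (nth 0%N e l :: s) w))%:E)%E).
rewrite (big_cat_nat _ (n := m))//=; congr (_ + _)%E.
by rewrite big_mkord; apply: eq_bigr => l _; rewrite nths.
Qed.

(** With [e = s] no separate terms remain, and taking for [G] the indicator of [S] shows that
    [kappa] integrates to zero over every event [X_s] in [S]. The set where [kappa] is nonnegative
    and its complement then give a vanishing integral of [|kappa|]. *)
Let ae_kappa i s : size s = m -> uniq (i :: s) ->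
  {ae P, forall w, kappa (subvector m s w) = 0}.
Proof.
move=> sm uis.
have ik (S : set (m.-tuple T)) : measurable S ->
    P.-integrable setT (fun w => (\1_S (subvector m s w) * kappa (subvector m s w))%:E) /\
    (\int[P]_w (\1_S (subvector m s w) * kappa (subvector m s w))%:E = 0)%E.
  move=> mS.
  have [iS eS] := integral_kappa sm uis sm uis (@measurable_id _ _ _) (fun=> erefl)
    (measurable_indic mS) (integrable_indic_h mS sm uis) (fun _ _ => erefl) (leqnn m).
  by split=> //; move: eS; rewrite big_geq// adde0 degenerate_indic// mule0 => <-.
have mk : measurable_fun setT (fun w => kappa (subvector m s w)).
  have [i1 _] := ik setT measurableT.
  apply: eq_measurable_fun (proj1 (measurable_EFinP _ _) (measurable_int _ i1)) => w _.
  by rewrite indicT mul1r.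
pose S := [set y | 0 <= kappa y].
have mS : measurable S.
  have mu := measurable_urn_mean sm uis sm uis (@measurable_id _ _ _) (fun=> erefl).
  have -> : S = kappa @^-1` `[0, +oo[%classic.
    by apply/seteqP; split=> y; rewrite /S /= in_itv /= andbT.
  rewrite -[X in measurable X]setTI.
  suff mkappa : measurable_fun setT kappa by apply: mkappa => //; exact: measurable_itv.
  apply: measurable_funD => //; apply: measurable_sum => l.
  apply: (measurableT_comp mh); apply: measurable_cons => //; exact: measurable_tnth.
have [i1 e1] := ik _ mS; have [i2 e2] := ik _ (measurableC mS).
have : (\int[P]_w `|(kappa (subvector m s w))%:E| = 0)%E.
  transitivity (\int[P]_w ((\1_S (subvector m s w) * kappa (subvector m s w))%:E -
      (\1_(~` S) (subvector m s w) * kappa (subvector m s w))%:E))%E.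
    apply: eq_integral => w _; rewrite -EFinB; congr EFin; rewrite !indicE in_setC.
    have [kS|kS] := boolP (_ \in S); rewrite /= ?mul1r ?mul0r ?subr0 ?sub0r.
      by rewrite ger0_norm//; move: kS; rewrite inE.
    rewrite ltr0_norm// ltNge; apply/negP => k0; move/negP: kS; apply.
    by rewrite inE.
  by rewrite integralB// e1 e2 sube0.
move=> k0; have [+ _] := ae_eq_integral_abs P measurableT (proj2 (measurable_EFinP _ _) mk).
move=> /(_ k0); apply: filterS => w /(_ I) /= [].
by [].
Qed.

(* Given [X_s], the conditional mean of [h] vanishes: of the values that the new
   variable [X_i] can copy, only those in [a] contribute. *)
Lemma degenerate_step i s a (G : (size (s ++ a)).-tuple T -> R) :
  size s = m -> uniq (i :: s ++ a) -> measurable_fun setT G ->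
  sq_integrable P (G \o subvector _ (s ++ a)) ->
  ((theta + (size (s ++ a))%:R)%:E * \int[P]_w
     (G (subvector _ (s ++ a) w) * h (subvector m.+1 (i :: s) w))%:E =
   \sum_(l <- a) \int[P]_w
     (G (subvector _ (s ++ a) w) * h (subvector m.+1 (l :: s) w))%:E)%E.
Proof.
move=> sm uisa mG sG.
have uis : uniq (i :: s).
  by move: uisa; rewrite /= mem_cat cat_uniq negb_or => /andP[/andP[-> _] /andP[->]].
pose r (t : (size (s ++ a)).-tuple T) := [tuple nth point t j | j < m].
have mr : measurable_fun setT r.
  by apply: measurable_mktuple => j; exact: (measurable_nth _ _ (@measurable_id _ _ _)).
have msa : (m <= size (s ++ a))%N by rewrite size_cat sm leq_addr.
have rE w : r (subvector _ (s ++ a) w) = subvector m s w.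
  apply: eq_from_tnth => j; rewrite !tnth_mktuple.
  rewrite -[nat_of_ord j]/(nat_of_ord (widen_ord msa j)) -tnth_nth tnth_mktuple.
  by rewrite /= nth_cat sm ltn_ord.
have iG : P.-integrable setT
    (fun w => (G (subvector _ (s ++ a) w) * h (subvector m.+1 (i :: s) w))%:E).
  by apply: (sq_integrableM sG); apply: sq_sub => //=; rewrite sm.
have nths l : (l < m)%N -> nth 0%N s l = nth 0%N (s ++ a) l.
  by move=> lm; rewrite nth_cat sm lm.
have [ik ->] := integral_kappa erefl uisa sm uis mr rE mG iG nths msa.
have -> : (\int[P]_w (G (subvector _ (s ++ a) w) * kappa (subvector m s w))%:E = 0)%E.
  rewrite -[RHS](integral0 P setT); apply: ae_eq_integral => //.
    exact: measurable_int ik.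
  by apply: filterS (ae_kappa sm uis) => w -> _; rewrite mulr0.
rewrite add0e -[X in \big[_/_]_(X <= _ < _) _]add0n big_addn [RHS](big_nth 0%N).
have -> : (size (s ++ a) - m = size a)%N by rewrite size_cat sm addKn.
by apply: eq_bigr => l _; rewrite nth_cat sm ltnNge leq_addl /= addnK.
Qed.

(* The ratio of the correlation of [h] on two index sets differing in [k] indices to
   its second moment; each step moves one differing index by [degenerate_step]. *)
Fixpoint overlap_coef k : R :=
  if k is k'.+1 then k'.+1%:R / (theta + (m.+1 + k')%:R) * overlap_coef k' else 1.

Lemma overlap_coef_gt0 k : 0 < overlap_coef k.
Proof. by elim: k => //= k IH; rewrite mulr_gt0// divr_gt0// ltr_wpDr. Qed.

Let norm_h := (\int[P]_w (h (subvector m.+1 (iota 0 m.+1) w) ^+ 2)%:E)%E.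

Lemma integral_sqr_subvector e : size e = m.+1 -> uniq e ->
  (\int[P]_w (h (subvector m.+1 e w) ^+ 2)%:E = norm_h)%E.
Proof.
move=> em ue; have mh2 : measurable_fun setT (fun t => (h t ^+ 2)%:E).
  exact/measurable_EFinP/measurable_funX.
have h20 t : (0 <= (h t ^+ 2)%:E)%E by rewrite lee_fin sqr_ge0.
rewrite (ge0_integral_subvector XDQ em ue mh2 h20).
by rewrite -(ge0_integral_subvector XDQ (size_iota 0 m.+1) (iota_uniq _ _) mh2 h20).
Qed.

(** For [k.+1] differing indices, one index [i] of the second list is viewed as new. By degeneracy
    it can only copy some [l] in [a], which makes [l] common and leaves [k] differing indices. There
    are [k.+1] choices of [l], and the draw of [X_i] is preceded by [m.+1 + k] variables, whence the
    factor in [overlap_coef]. *)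
Lemma integral_overlap k c a b : (size c + k = m.+1)%N -> size a = k -> size b = k ->
  uniq (c ++ a ++ b) ->
  (\int[P]_w (h (subvector m.+1 (c ++ a) w) * h (subvector m.+1 (c ++ b) w))%:E =
   (overlap_coef k)%:E * norm_h)%E.
Proof.
elim: k c a b => [|k IH] c a b ck ak bk ucab.
  move: ck ucab; rewrite (size0nil ak) (size0nil bk) addn0 !cats0 /= mul1e => ck uc.
  by rewrite -(integral_sqr_subvector ck uc); apply: eq_integral => w _.
case: b bk ucab => [//|i b] [bk] ucab; pose s := c ++ b.
have sm : size s = m by rewrite size_cat bk; move: ck; rewrite addnS => -[].
have perm_isa : perm_eq (c ++ a ++ i :: b) (i :: s ++ a).
  by apply/seq.permP => p; rewrite /s /= !count_cat /=; lia.
have uisa : uniq (i :: s ++ a) by rewrite -(perm_uniq perm_isa).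
(* All indices of [c ++ a] occur in [s ++ a], so the first factor can be read off the larger vector
   by looking up positions. *)
pose G (t : (size (s ++ a)).-tuple T) :=
  h [tuple nth point t (index (nth 0%N (c ++ a) j) (s ++ a)) | j < m.+1].
have mG : measurable_fun setT G.
  apply: (measurableT_comp mh); apply: measurable_mktuple => j.
  exact: (measurable_nth _ _ (@measurable_id _ _ _)).
have size_ca : size (c ++ a) = m.+1 by rewrite size_cat ak.
have GE w : G (subvector _ (s ++ a) w) = h (subvector m.+1 (c ++ a) w).
  congr h; apply: eq_from_tnth => j; rewrite !tnth_mktuple.
  have jsa : nth 0%N (c ++ a) j \in s ++ a.
    have : nth 0%N (c ++ a) j \in c ++ a by rewrite mem_nth// size_ca.
    by rewrite !mem_cat => /orP[->//|->]; rewrite orbT.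
  have lt_sa : (index (nth 0%N (c ++ a) j) (s ++ a) < size (s ++ a))%N by rewrite index_mem.
  rewrite -[index _ _]/(nat_of_ord (Ordinal lt_sa)) -tnth_nth tnth_mktuple /=.
  by rewrite nth_index.
have uca : uniq (c ++ a) by move: ucab; rewrite catA cat_uniq => /andP[].
have sG : sq_integrable P (G \o subvector _ (s ++ a)).
  by rewrite (_ : _ \o _ = h \o subvector m.+1 (c ++ a)); [exact: sq_sub|exact/funext].
have nsa : size (s ++ a) = (m.+1 + k)%N by rewrite size_cat sm ak addnS.
have := degenerate_step sm uisa mG sG.
under eq_integral => w _.
  rewrite GE -(subvector_perm (e := c ++ i :: b) (e' := i :: s) _ symh); last 2 first.
  - by rewrite size_cat /= bk.
  - by apply/seq.permP => p; rewrite /s /= !count_cat /=; lia.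
  over.
set E := (\int[P]_w _)%E => Estep.
have {}Estep : ((theta + (m.+1 + k)%:R)%:E * E =
    (k.+1%:R * overlap_coef k)%:E * norm_h)%E.
  rewrite -nsa Estep.
  transitivity (\sum_(l <- a) (overlap_coef k)%:E * norm_h)%E.
    rewrite big_seq [RHS]big_seq; apply: eq_bigr => l la.
    (* The copied index [l] leaves [a] and joins the common part. *)
    rewrite -(IH (l :: c) (rem l a) b)//.
    - apply: eq_integral => w _; rewrite GE; congr (_ * _)%:E.
      apply: subvector_perm => //; apply/seq.permP => p.
      by rewrite /= !count_cat (seq.permP (perm_to_rem la)) /=; lia.
    - by rewrite /= addSn -addnS.
    - by rewrite size_rem// ak.
    - suff <- : uniq (s ++ a) = uniq ((l :: c) ++ rem l a ++ b) by case/andP: uisa.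
      apply: perm_uniq; apply/seq.permP => p.
      by rewrite /s /= !count_cat (seq.permP (perm_to_rem la)) /=; lia.
  have /sq_integrableP[_ /(integrable_fin_num measurableT) nfin] := sqh.
  rewrite -(fineK (nfin : norm_h \is a fin_num)) -!EFinM sumEFin; congr EFin.
  by rewrite big_const_seq count_predT ak iter_addr_0 -[LHS]mulr_natl mulrA.
have Egt0 : 0 < theta + (m.+1 + k)%:R by rewrite ltr_wpDr.
have -> : E = ((theta + (m.+1 + k)%:R)^-1%:E * ((theta + (m.+1 + k)%:R)%:E * E))%E.
  by rewrite muleA -EFinM mulVf ?mul1e// gt_eqF.
by rewrite Estep muleA -EFinM mulrCA mulrA.
Qed.

(** For two disjoint index lists the correlation is the second moment of the integral. With
    [N = m.+1], the constant is N! divided by the product of the [theta + j] for [j] from [N] to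
    [2N - 1]. *)
Lemma integral_directing_sqr :
  (\int[P]_w (directing_integral D h w ^+ 2)%:E = (overlap_coef m.+1)%:E * norm_h)%E.
Proof.
have u2 : uniq (iota 0 m.+1 ++ iota m.+1 m.+1) by rewrite -iotaD iota_uniq.
rewrite -(integral_pair XDQ mh sqh (size_iota 0 m.+1) (size_iota m.+1 m.+1) u2).
by rewrite -(@integral_overlap m.+1 [::] (iota 0 m.+1) (iota m.+1 m.+1))//= size_iota.
Qed.

End degenerate.

(** * U-statistics *)

Section overlapping_pairs.
Local Open Scope set_scope.
Local Open Scope nat_scope.
Variables (K N : nat).

Definition increasing (j : N.-tuple 'I_K) := sorted ltn (map val j).

Definition overlapping (p : N.-tuple 'I_K * N.-tuple 'I_K) :=
  [&& increasing p.1, increasing p.2 & has (mem p.1) p.2].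

Lemma increasing_inj (j j' : N.-tuple 'I_K) :
  increasing j -> increasing j' -> [set x in j] = [set x in j'] -> j = j'.
Proof.
move=> sj sj' /setP jj'; apply/val_inj/(inj_map val_inj).
apply: (irr_sorted_eq ltn_trans ltnn sj sj') => k.
by apply/mapP/mapP => -[x xj ->]; exists x => //; have := jj' x; rewrite !inE xj.
Qed.

(** An increasing tuple is determined by its set of entries; removing [i] leaves an [N.-1]-subset of
    the other [K.-1] indices. *)
Lemma card_increasing_mem (i : 'I_K) : (0 < N)%N ->
  (#|[set j : N.-tuple 'I_K | increasing j & i \in j]| <= 'C(K.-1, N.-1))%N.
Proof.
move=> N0; pose f (j : N.-tuple 'I_K) := [set x in j] :\ i.
rewrite -(card_in_imset (f := f)); last first.
  move=> j j'; rewrite !inE => /andP[sj ij] /andP[sj' ij'] ff.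
  apply: increasing_inj => //.
  rewrite -(finset.setD1K (_ : i \in [set x in j])) ?inE//.
  by rewrite -(finset.setD1K (_ : i \in [set x in j'])) ?inE// -/(f _) ff.
have -> : 'C(K.-1, N.-1) = 'C(#|[set~ i]|, N.-1) by rewrite cardsC1 card_ord.
rewrite -cards_draws; apply/subset_leq_card/fintype.subsetP => _ /imsetP[j + ->].
rewrite !inE => /andP[sj ij]; apply/andP; split.
  by apply/fintype.subsetP => x; rewrite !inE => /andP[].
have := cardsD1 i [set x in j]; rewrite inE ij cardsE.
have /card_uniqP -> : uniq j.
  by rewrite -(map_inj_uniq val_inj); exact: sorted_uniq ltn_trans ltnn _ sj.
by rewrite size_tuple -/(f j) => ->; rewrite add1n.
Qed.

(** A union bound over the common index: [K] values, each with at most the square of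
    ['C(K.-1, N.-1)] pairs, where [K] times this coefficient is [N] times ['C(K, N)]. *)
Lemma card_overlapping : (0 < N)%N ->
  (#|[set p | overlapping p]| * K <= N ^ 2 * 'C(K, N) ^ 2)%N.
Proof.
move=> N0; pose c (i : 'I_K) := [set j : N.-tuple 'I_K | increasing j & i \in j].
have ovc : (#|[set p | overlapping p]| <= \sum_(i < K) #|c i| * #|c i|)%N.
  rewrite -sum1dep_card.
  under [leqRHS]eq_bigr do rewrite -cardsX -sum1_card.
  rewrite (exchange_big_dep xpredT)//= big_mkcond; apply: leq_sum => -[j j'] _.
  case: ifPn => // /and3P[/= sj sj' /hasP[i ij' ij]].
  by rewrite (bigD1 i)//= !inE sj sj' /= (ij : i \in j) ij'.
rewrite (leq_trans (leq_mul ovc (leqnn K)))//.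
have cK (i : 'I_K) : (#|c i| * K <= N * 'C(K, N))%N.
  rewrite (leq_trans (leq_mul (card_increasing_mem i N0) (leqnn K)))//.
  have K0 : (0 < K)%N by rewrite (leq_ltn_trans _ (ltn_ord i)).
  by rewrite mulnC -{1}(prednK K0) mul_bin_diag (prednK N0) (prednK K0).
have : \sum_(i < K) (#|c i| * K) ^ 2 <= \sum_(i < K) (N * 'C(K, N)) ^ 2.
  by apply: leq_sum => i _; rewrite leq_sqr.
have -> : \sum_(i < K) (#|c i| * K) ^ 2 = (\sum_(i < K) #|c i| * #|c i|) * K * K.
  by rewrite -mulnA big_distrl; apply: eq_bigr => i _; rewrite -mulnn mulnACA.
rewrite sum_nat_const card_ord expnMn.
have [K0|K0] := posnP K; last by rewrite [X in _ <= X]mulnC leq_pmul2r.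
move=> _; apply: leq_trans (leq0n _); rewrite leqn0 muln_eq0; apply/orP; right.
exact/eqP.
Qed.

End overlapping_pairs.

Section ustatistic.
Context d (Omega : measurableType d) (R : realType) (P : probability Omega R).
Context d' (T : measurableType d').
Variables (X : nat -> {RV P >-> T}) (D : {RV P >-> pprobability T R}).
Variables (Q : seq (set T) -> \bar R).

Hypothesis XDQ : forall (Cs : seq (set T)) (s : seq (nat * set T)),
  uniq (map fst s) -> (forall p, p \in s -> measurable p.2) ->
  (forall C, C \in Cs -> measurable C) ->
  (\int[P]_w (\prod_(p <- s) \1_(p.2) (X p.1 w) *
               \prod_(C <- Cs) fine ((D w : probability T R) C))%:E =
   Q (map snd s ++ Cs))%E.

Variables (N : nat) (h : N.-tuple T -> R).
Hypothesis N_gt0 : (0 < N)%N.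
Hypothesis mh : measurable_fun setT h.
Hypothesis sqh : sq_integrable P (h \o subvector X N (iota 0 N)).

Let I := directing_integral D h.
Let sqI : sq_integrable P I := sq_integrable_directing XDQ mh sqh.
Let H (e : seq nat) w := h (subvector X N e w).
Let sqH e (en : size e = N) (ue : uniq e) : sq_integrable P (H e) :=
  sq_integrable_subvector XDQ mh sqh en ue.
Let a e w := H e w - I w.
Let sqa e (en : size e = N) (ue : uniq e) : sq_integrable P (a e) :=
  sq_integrableB (sqH en ue) sqI.

Let E (f : Omega -> R) : R := \int[P]_w f w.
Let v := E (fun w => I w ^+ 2).
Let V := E (fun w => H (iota 0 N) w ^+ 2).

Let EHI e : size e = N -> uniq e -> E (fun w => H e w * I w) = v.
Proof. by move=> en ue; congr fine; exact: (integral_mixed XDQ mh sqh en ue). Qed.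

Let EHH e e' : size e = N -> size e' = N -> uniq (e ++ e') ->
  E (fun w => H e w * H e' w) = v.
Proof. by move=> en en' ue; congr fine; exact: (integral_pair XDQ mh sqh en en' ue). Qed.

Let EH2 e : size e = N -> uniq e -> E (fun w => H e w ^+ 2) = V.
Proof.
move=> en ue; congr fine; have mh2 : measurable_fun setT (fun t => (h t ^+ 2)%:E).
  exact/measurable_EFinP/measurable_funX.
have h20 t : (0 <= (h t ^+ 2)%:E)%E by rewrite lee_fin sqr_ge0.
rewrite (ge0_integral_subvector XDQ en ue mh2 h20).
by rewrite -(ge0_integral_subvector XDQ (size_iota 0 N) (iota_uniq _ _) mh2 h20).
Qed.

Let expand f g : sq_integrable P f -> sq_integrable P g ->
  E (fun w => (f w - I w) * (g w - I w)) =
  E (fun w => f w * g w) - E (fun w => f w * I w) - E (fun w => g w * I w) + v.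
Proof.
move=> sf sg; have i1 := sq_integrableM sf sg; have i2 := sq_integrableM sf sqI.
have i3 := sq_integrableM sg sqI; have i4 := sq_integrableM sqI sqI.
have i12 : P.-integrable setT (EFin \o (fun w => f w * g w - f w * I w)) :=
  integrableB measurableT i1 i2.
have i123 : P.-integrable setT (EFin \o (fun w => f w * g w - f w * I w - g w * I w)) :=
  integrableB measurableT i12 i3.
rewrite /v /E -RintegralB// -RintegralB//.
rewrite (_ : \int[P]_w (I w ^+ 2) = \int[P]_w (I w * I w))// -RintegralD//.
by apply: eq_Rintegral => w _; ring.
Qed.

Let E_disjoint e e' : size e = N -> size e' = N -> uniq (e ++ e') ->
  E (fun w => a e w * a e' w) = 0.
Proof.
move=> en en' uee; have := uee; rewrite cat_uniq => /and3P[ue _ ue'].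
rewrite expand; [|exact: sqH|exact: sqH].
(* All four terms of the expansion equal [v]. *)
by rewrite EHH// !EHI// subrr sub0r addNr.
Qed.

Let v_ge0 : 0 <= v.
Proof. by apply: Rintegral_ge0 => w _; exact: sqr_ge0. Qed.

Let E_sqr e : size e = N -> uniq e -> E (fun w => a e w ^+ 2) <= V.
Proof.
move=> en ue; have -> : E (fun w => a e w ^+ 2) = E (fun w => a e w * a e w).
  by apply: eq_Rintegral => w _; rewrite expr2.
rewrite expand; [|exact: sqH|exact: sqH].
rewrite EHI// -[E _]/(E (fun w => H e w ^+ 2)) EH2//.
by rewrite -addrA addNr addr0 lerBlDr lerDl.
Qed.

(** [x * y] is at most half of [x ^ 2 + y ^ 2]. The bound [V] is crude but does not depend on the
    indices, as the count of overlapping pairs requires. *)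
Let E_prod e e' : size e = N -> size e' = N -> uniq e -> uniq e' ->
  E (fun w => a e w * a e' w) <= V.
Proof.
move=> en en' ue ue'.
have i1 := sq_integrableM (sqa en ue) (sqa en' ue').
have i2 := sq_integrableM (sqa en ue) (sqa en ue).
have i3 := sq_integrableM (sqa en' ue') (sqa en' ue').
have i23 := integrableZl measurableT 2^-1 (integrableD measurableT i2 i3).
apply: (@le_trans _ _ (E (fun w => 2^-1 * (a e w ^+ 2 + a e' w ^+ 2)))).
  apply: le_Rintegral => // w _; rewrite -subr_ge0.
  have -> : 2^-1 * (a e w ^+ 2 + a e' w ^+ 2) - a e w * a e' w =
    2^-1 * (a e w - a e' w) ^+ 2 by field.
  by rewrite mulr_ge0// sqr_ge0.
rewrite /E RintegralZl//; last exact: (integrableD measurableT i2 i3).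
rewrite RintegralD// -/(E _) -/(E _).
rewrite mulrC ler_pdivrMr// mulrDr mulr1.
by apply: lerD; exact: E_sqr.
Qed.

Let E_sum (J : Type) (s : seq J) (p : pred J) (f : J -> Omega -> R) :
  (forall j, p j -> P.-integrable setT (EFin \o f j)) ->
  E (fun w => \sum_(j <- s | p j) f j w) = \sum_(j <- s | p j) E (f j).
Proof.
move=> intf.
have ints s' : P.-integrable setT (EFin \o (fun w => \sum_(j <- s' | p j) f j w)).
  have : P.-integrable setT (fun w => \sum_(j <- s' | p j) (f j w)%:E)%E.
    exact: integrable_sum.
  by apply: eq_integrable => // w _ /=; rewrite sumEFin.
elim: s => [|j s IH].
  rewrite big_nil -[RHS](mul0r (fine (P setT))) -Rintegral_cst//.
  by apply: eq_Rintegral => w _; rewrite big_nil.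
rewrite big_cons -IH; case pj : (p j).
  by rewrite -RintegralD//; [apply: eq_Rintegral => w _; rewrite big_cons pj|exact: intf].
by apply: eq_Rintegral => w _; rewrite big_cons pj.
Qed.

Let ustat K w := ('C(K, N)%:R)^-1 *
  \sum_(j : N.-tuple 'I_K | sorted ltn (map val j)) h [tuple X (tnth j i) w | i < N].

Let size_inc K (j : N.-tuple 'I_K) : size (map val j) = N.
Proof. by rewrite size_map size_tuple. Qed.

Let uniq_inc K (j : N.-tuple 'I_K) : increasing j -> uniq (map val j).
Proof. exact: sorted_uniq ltn_trans ltnn _. Qed.

Let HE K (j : N.-tuple 'I_K) w : h [tuple X (tnth j i) w | i < N] = H (map val j) w.
Proof.
congr h; apply: eq_from_tnth => i; rewrite !tnth_mktuple.
by rewrite (nth_map (tnth j i)) ?size_tuple// -tnth_nth.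
Qed.

Let card_inc K : #|[pred j : N.-tuple 'I_K | increasing j]| = 'C(K, N).
Proof.
by rewrite -card_ltn_sorted_tuples; apply: eq_card => j; rewrite inE /increasing.
Qed.

(** Centering commutes with the average because there are exactly ['C(K, N)] increasing tuples. For
    [K < N] the coefficient and its conventional inverse are 0, hence the restriction. *)
Let ustatE K w : (N <= K)%N -> ustat K w - I w =
  ('C(K, N)%:R)^-1 * \sum_(j : N.-tuple 'I_K | increasing j) a (map val j) w.
Proof.
move=> NK; rewrite /ustat sumrB mulrBr; congr (_ - _).
  by congr (_ * _); apply: eq_bigr => j _; rewrite HE.
rewrite sumr_const -[#|_|]/(#|[pred j : N.-tuple 'I_K | increasing j]|) card_inc.
by rewrite -[I w *+ _]mulr_natl mulKf// pnatr_eq0 -lt0n bin_gt0.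
Qed.

Lemma ustat_integrable K : sq_integrable P (ustat K).
Proof.
apply: sq_integrableZ; apply: sq_integrable_sum => j sj.
rewrite (_ : (fun w => _) = H (map val j)); last by apply/funext => w; exact: HE.
exact: sqH (size_inc j) (uniq_inc sj).
Qed.

Lemma ustat_bound K : (N <= K)%N ->
  (\int[P]_w ((ustat K w - I w) ^+ 2)%:E <= ((N ^ 2)%:R * V / K%:R)%:E)%E.
Proof.
move=> NK; have K_gt0 : (0 < K)%N by exact: leq_trans NK.
have C_gt0 : 0 < 'C(K, N)%:R :> R by rewrite ltr0n bin_gt0.
have sU := sq_integrableB (ustat_integrable K) sqI.
have /sq_integrableP[_ iU] := sU.
rewrite -[leLHS](fineK (integrable_fin_num measurableT iU)) lee_fin.
pose pr (p : N.-tuple 'I_K * N.-tuple 'I_K) w := a (map val p.1) w * a (map val p.2) w.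
have ipr p : increasing p.1 && increasing p.2 -> P.-integrable setT (EFin \o pr p).
  move=> /andP[s1 s2].
  exact: sq_integrableM (sqa (size_inc _) (uniq_inc s1)) (sqa (size_inc _) (uniq_inc s2)).
have -> : fine (\int[P]_w ((ustat K w - I w) ^+ 2)%:E)%E =
    ('C(K, N)%:R ^- 2) * \sum_(p | increasing p.1 && increasing p.2) E (pr p).
  rewrite -E_sum// -RintegralZl//; last first.
    have : P.-integrable setT
        (fun w => \sum_(p | increasing p.1 && increasing p.2) (pr p w)%:E)%E.
      exact: integrable_sum.
    by apply: eq_integrable => // w _ /=; rewrite sumEFin.
  apply: eq_Rintegral => w _; rewrite ustatE// exprMn exprVn; congr (_ * _).
  by rewrite expr2 big_distrlr /= pair_big.
rewrite (bigID (fun p : N.-tuple 'I_K * N.-tuple 'I_K => has (mem p.1) p.2)) /=.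
rewrite [X in _ * (_ + X)]big1 ?addr0; last first.
  move=> p /andP[/andP[s1 s2] dis]; apply: E_disjoint => //.
  rewrite cat_uniq !uniq_inc//= andbT.
  apply: contra dis => /hasP[x /mapP[k kp ->]]; rewrite (mem_map val_inj) => kp'.
  by apply/hasP; exists k.
apply: (@le_trans _ _ ('C(K, N)%:R ^- 2 * (#|[set p | @overlapping K N p]%SET|%:R * V))).
  rewrite ler_wpM2l// ?invr_ge0 ?exprn_ge0//.
  rewrite -sum1dep_card natr_sum mulr_suml /overlapping.
  under eq_bigl do rewrite -andbA.
  apply: ler_sum => p /and3P[s1 s2 _]; rewrite mul1r.
  by apply: E_prod => //; exact: uniq_inc.
have V0 : 0 <= V by apply: Rintegral_ge0 => w _; exact: sqr_ge0.
rewrite ler_pdivlMr ?ltr0n// -mulrA mulrC ler_pdivrMr ?exprn_gt0//.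
rewrite mulrAC [leRHS]mulrAC; apply: ler_wpM2r => //.
by rewrite -natrM -natrX -natrM ler_nat card_overlapping.
Qed.

Lemma ustat_cvg : (fun K => \int[P]_w ((ustat K w - I w) ^+ 2)%:E)%E @ \oo --> 0%E.
Proof.
apply: (@squeeze_cvge _ _ _ _ (cst 0%E) _ (fun K => ((N ^ 2)%:R * V / K%:R)%:E)).
- exists N => // K /= NK; rewrite ustat_bound// andbT.
  by apply: integral_ge0 => w _; rewrite lee_fin sqr_ge0.
- exact: cvg_cst.
- apply: cvg_EFin; first exact: nearW.
  rewrite -(mulr0 ((N ^ 2)%:R * V)); apply: cvgMr.
  rewrite -cvg_shiftS; exact: cvg_harmonic.
Qed.

End ustatistic.

(** * Closedness of the space of integrals *)

Section L2_complete.
Context d (T : measurableType d) (R : realType) (mu : {measure set T -> \bar R}).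
Variable h : nat -> T -> R.
Hypothesis mh : forall n, measurable_fun setT (h n).

Let dist2 (f g : T -> R) := (\int[mu]_t ((f t - g t) ^+ 2)%:E)%E.

Hypothesis cauchy_h : forall e : R, 0 < e -> exists n0 : nat, forall m n : nat,
  (n0 <= m)%N -> (n0 <= n)%N -> (dist2 (h m) (h n) <= e%:E)%E.

Let msq (f g : T -> R) : measurable_fun setT f -> measurable_fun setT g ->
  measurable_fun setT (fun t => ((f t - g t) ^+ 2)%:E).
Proof. by move=> mf mg; apply/measurable_EFinP/measurable_funX/measurable_funB. Qed.

Let sq0 (f g : T -> R) t : (0 <= ((f t - g t) ^+ 2)%:E)%E.
Proof. by rewrite lee_fin sqr_ge0. Qed.

(** The rate has two factors: one absorbs the weight [2 ^ k] in [v], the other makes the integrals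
    of [v] summable. So the weighted squared increments have a finite sum almost everywhere, and up
    to a geometric series they dominate the increments themselves. *)
Lemma fast_cauchy_cvg (phi : nat -> nat) :
  (forall k, dist2 (h (phi k.+1)) (h (phi k)) <= ((2 ^ k * 2 ^ k.+1)%:R^-1)%:E)%E ->
  {ae mu, forall t, cvgn (fun k => h (phi k) t)}.
Proof.
move=> phiP; pose u t k := h (phi k.+1) t - h (phi k) t.
pose v t k : R := (2 ^ k)%:R * u t k ^+ 2.
have v0 t k : 0 <= v t k by rewrite mulr_ge0// sqr_ge0.
have mv k : measurable_fun setT (fun t => (v t k)%:E).
  apply/measurable_EFinP; apply: measurable_funM => //.
  by apply: measurable_funX; exact: measurable_funB.
have sv0 t : (0 <= \sum_(k <oo) (v t k)%:E)%E.
  by apply: nneseries_ge0 => k _ _; rewrite lee_fin.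
have iv : mu.-integrable setT (fun t => \sum_(k <oo) (v t k)%:E)%E.
  apply/integrableP; split.
    have := @ge0_emeasurable_sum _ T R setT (fun k t => (v t k)%:E) xpredT.
    by apply => n *; [rewrite lee_fin|exact: mv].
  under eq_integral do rewrite gee0_abs//.
  rewrite integral_nneseries//; last by move=> k t _; rewrite lee_fin.
  apply: (@le_lt_trans _ _ (\sum_(k <oo) (1 / (2 ^ k.+1)%:R)%:E)%E); last first.
    by rewrite (le_lt_trans (epsilon_trick0 _ _))// ltry.
  apply: lee_nneseries => [k _ _|k _]; first by apply: integral_ge0 => t _; rewrite lee_fin.
  under eq_integral do rewrite EFinM.
  rewrite ge0_integralZl//; last 2 first.
  - exact: msq.
  - by move=> t _; rewrite lee_fin sqr_ge0.
  apply: le_trans (lee_wpmul2l _ (phiP k)) _ => //.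
  by rewrite -EFinM lee_fin natrM invfM mulrA mulfV// pnatr_eq0 expn_eq0.
have := integrable_ae measurableT iv; apply: filterS => t /(_ I) vfin.
have cv : cvgn (series (v t)).
  apply: nondecreasing_is_cvgn.
    by apply: nondecreasing_series => n _ _; exact: v0.
  exists (fine (\sum_(k <oo) (v t k)%:E)%E) => _ [n _ <-].
  rewrite -lee_fin fineK// /series/= -sumEFin.
  by apply: nneseries_lim_ge => k _ _; rewrite lee_fin.
have cu : cvgn (series (u t)).
  apply: normed_cvg; apply: (@series_le_cvg _ _ (v t \+ geometric 1 2^-1)).
  - by move=> n; exact: normr_ge0.
  - by move=> n; rewrite addr_ge0//= mul1r exprn_ge0.
  - move=> n /=; rewrite mul1r exprVn /v natrX.
    have q0 : 0 < 2 ^+ n :> R by rewrite exprn_gt0.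
    set q := 2 ^+ n in q0 *; rewrite -(real_normK (num_real (u t n))).
    set x := `|u t n|; have x0 : 0 <= x by exact: normr_ge0.
    (* Completing the square shows that [2 * x] is at most [q * x ^+ 2 + q^-1], which passes from
       squared to plain increments. *)
    have -> : q * x ^+ 2 + q^-1 = (q * x - 1) ^+ 2 / q + 2 * x by field; rewrite gt_eqF.
    rewrite -[leLHS]add0r lerD//; first by rewrite divr_ge0 ?sqr_ge0// ltW.
    by rewrite ler_peMl// ler1n.
  - apply: is_cvg_seriesD => //; apply: is_cvg_geometric_series.
    by rewrite ger0_norm// invf_lt1// ltr1n.
have -> : (fun k => h (phi k) t) = (fun k => h (phi 0%N) t + series (u t) k).
  by apply/funext => k; rewrite (eq_sum_telescope (fun k => h (phi k) t) k).
by apply: is_cvgD => //; exact: is_cvg_cst.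
Qed.

(* The limit is given by an explicit formula in order to inherit pointwise
   properties of [h], such as symmetry. *)
Lemma L2_complete : exists phi : nat -> nat,
  let g t := fine (limn_esup (fun k => (h (phi k) t)%:E)) in
  [/\ measurable_fun setT g, forall k, (k <= phi k)%N &
      forall k, (dist2 (h (phi k)) g <= ((2 ^ k * 2 ^ k.+1)%:R^-1)%:E)%E].
Proof.
have /choice[n0 n0P] (k : nat) : exists n0 : nat, forall m n : nat,
    (n0 <= m)%N -> (n0 <= n)%N -> (dist2 (h m) (h n) <= ((2 ^ k * 2 ^ k.+1)%:R^-1)%:E)%E.
  by apply: cauchy_h; rewrite invr_gt0 ltr0n muln_gt0 !expn_gt0.
(* The sum puts [phi m] beyond every threshold [n0 k] with [k <= m], although [n0] need not be
   monotone; the last summand makes [phi] unbounded. *)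
pose phi k := (\sum_(i < k.+1) n0 i + k)%N; exists phi => g.
have n0phi k m : (k <= m)%N -> (n0 k <= phi m)%N.
  move=> km; rewrite /phi (bigD1 (inord k : 'I_m.+1))//= inordK ?ltnS//.
  by rewrite -addnA leq_addr.
have mg : measurable_fun setT g.
  apply: measurableT_comp => //; apply: measurable_fun_limn_esup => k.
  exact/measurable_EFinP.
split=> // k; first by rewrite /phi leq_addl.
have cphi : {ae mu, forall t, cvgn (fun k => h (phi k) t)}.
  by apply: fast_cauchy_cvg => j; apply: n0P; exact: n0phi.
(* As [g] is almost everywhere the limit of the subsequence, the distance to [g] is the integral of
   a lower limit, and Fatou bounds it by the distances between late terms. *)
have -> : dist2 (h (phi k)) g =
    (\int[mu]_t limn_einf (fun m => ((h (phi k) t - h (phi m) t) ^+ 2)%:E))%E.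
  apply: ge0_ae_eq_integral => //.
  - exact: msq.
  - apply: measurableT_comp => //; apply: measurable_fun_limn_esup => m.
    by apply: measurableT_comp => //; exact: msq.
  - move=> t _; rewrite limn_einf_lim; apply: lime_ge; first exact: is_cvg_einfs.
    apply: nearW => n; apply: le_ereal_inf_tmp => _ [m _ <-].
    by rewrite lee_fin sqr_ge0.
  apply: filterS cphi => t /cvg_ex[l hl] _.
  have /cvg_limn_einf_sup[_ gl] : (fun k => (h (phi k) t)%:E) @ \oo --> l%:E.
    by apply: cvg_EFin => //; exact: nearW.
  have /cvg_limn_einf_sup[-> _] :
      (fun m => ((h (phi k) t - h (phi m) t) ^+ 2)%:E) @ \oo --> ((h (phi k) t - l) ^+ 2)%:E.
    apply: cvg_EFin; first exact: nearW.
    have hd : (fun m => h (phi k) t - h (phi m) t) @ \oo --> h (phi k) t - l.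
      by apply: cvgB => //; exact: cvg_cst.
    exact: (cvgM hd hd).
  by rewrite /g gl.
apply: le_trans (fatou _ _ _ _) _ => //.
- by move=> m; exact: msq.
- rewrite limn_einf_lim; apply: lime_le; first exact: is_cvg_einfs.
  apply: nearW => n; apply: (@le_trans _ _ (dist2 (h (phi k)) (h (phi (maxn k n))))).
    by apply: ereal_inf_lbound; exists (maxn k n) => //=; exact: leq_maxr.
  by apply: n0P; apply: n0phi => //; exact: leq_maxl.
Qed.

End L2_complete.

Section degenerate_space.
Context d (Omega : measurableType d) (R : realType) (P : probability Omega R).
Context d' (T : measurableType d').
Variables (X : nat -> {RV P >-> T}) (D : {RV P >-> pprobability T R}).
Variables (Q : seq (set T) -> \bar R).
Variables (alpha : {finite_measure set T -> \bar R}) (theta : R).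
Hypothesis theta_gt0 : 0 < theta.

Hypothesis XDQ : forall (Cs : seq (set T)) (s : seq (nat * set T)),
  uniq (map fst s) -> (forall p, p \in s -> measurable p.2) ->
  (forall C, C \in Cs -> measurable C) ->
  (\int[P]_w (\prod_(p <- s) \1_(p.2) (X p.1 w) *
               \prod_(C <- Cs) fine ((D w : probability T R) C))%:E =
   Q (map snd s ++ Cs))%E.

Hypothesis Q_perm : forall Cs Cs' : seq (set T), (forall C, C \in Cs -> measurable C) ->
  perm_eq Cs Cs' -> Q Cs = Q Cs'.

Hypothesis Q_rcons : forall (Bs : seq (set T)) (C : set T),
  (forall B, B \in Bs -> measurable B) -> measurable C ->
  ((theta + (size Bs)%:R)%:E * Q (rcons Bs C) =
   alpha C * Q Bs + \sum_(l < size Bs) Q (set_nth setT Bs l (nth setT Bs l `&` C)))%E.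

Variable m : nat.
Implicit Types h g : m.+1.-tuple T -> R.

Let x_ := subvector X m.+1 (iota 0 m.+1).
Let mx_ : measurable_fun setT x_ := measurable_subvector X (iota 0 m.+1).

(** The content of [Xi], with the vanishing conditional expectation tested on events determined by
    the first [m] variables. *)
Definition degenerate h : Prop :=
  [/\ forall (s : 'S_m.+1) t, h [tuple tnth t (s i) | i < m.+1] = h t,
      measurable_fun setT h,
      sq_integrable P (h \o x_) &
      forall S : set (m.-tuple T), measurable S ->
        (\int[P]_(w in subvector X m (iota 0 m) @^-1` S) (h (x_ w))%:E = 0)%E].

Let past_measurable (S : set (m.-tuple T)) : measurable S ->
  measurable (subvector X m (iota 0 m) @^-1` S).
Proof.
by move=> mS; rewrite -[X in measurable X]setTI; exact: measurable_subvector.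
Qed.

Lemma degenerate0 : degenerate (cst 0).
Proof.
split=> //; first exact: sq_integrable_cst.
by move=> S mS; rewrite integral0.
Qed.

Let integrable_on h (S : set (m.-tuple T)) : sq_integrable P (h \o x_) -> measurable S ->
  P.-integrable (subvector X m (iota 0 m) @^-1` S) (EFin \o (h \o x_)).
Proof.
move=> /sq_integrable_integrable ih mS.
by apply: integrableS ih => //; exact: past_measurable.
Qed.

Lemma degenerate_linear (a : R) h g : degenerate h -> degenerate g ->
  degenerate (fun t => a * h t + g t).
Proof.
move=> [symh mh sqh degh] [symg mg sqg degg]; split.
- by move=> s t; rewrite symh symg.
- by apply: measurable_funD => //; exact: measurable_funM.
- exact: (sq_integrableD (sq_integrableZ a sqh) sqg).
move=> S mS; have mpS := past_measurable mS.
have ih := integrable_on sqh mS; have ig := integrable_on sqg mS.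
transitivity (\int[P]_(w in subvector X m (iota 0 m) @^-1` S)
  (a%:E * (h (x_ w))%:E + (g (x_ w))%:E))%E; first by [].
rewrite integralD//; last exact: integrableZl.
by rewrite integralZl// degh// degg// mule0 add0e.
Qed.

Lemma degenerateB h g : degenerate h -> degenerate g -> degenerate (fun t => h t - g t).
Proof.
move=> dh dg; have := degenerate_linear (-1) dg dh.
by congr degenerate; apply/funext => t; rewrite mulN1r addrC.
Qed.

Let I h := directing_integral D h.

Let sqI h : degenerate h -> sq_integrable P (I h).
Proof. by move=> [_ mh sqh _]; exact: (sq_integrable_directing XDQ mh sqh). Qed.

Lemma directing_integral_linear (a : R) h g : degenerate h -> degenerate g ->
  {ae P, forall w, I (fun t => a * h t + g t) w = a * I h w + I g w}.
Proof.
move=> [_ mh sqh _] [_ mg sqg _].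
have := ae_integrable_directing XDQ mh sqh.
apply: filterS2 (ae_integrable_directing XDQ mg sqg) => w ig ih.
rewrite /I /directing_integral.
rewrite -[LHS]/(\int[directing_power D m.+1 w]_t (a * h t + g t)).
rewrite RintegralD ?RintegralZl//.
exact: (integrableZl measurableT a ih).
Qed.

Lemma directing_integral_B h g : degenerate h -> degenerate g ->
  {ae P, forall w, I (fun t => h t - g t) w = I h w - I g w}.
Proof.
move=> dh dg; have := directing_integral_linear (-1) dg dh.
apply: filterS => w E; rewrite addrC -mulN1r -E; congr (I _ w).
by apply/funext => t; rewrite mulN1r addrC.
Qed.

Let c : R := overlap_coef theta m m.+1.
Let norm2 h := (\int[P]_w (h (x_ w) ^+ 2)%:E)%E.

Lemma directing_integral_isometry h : degenerate h ->
  (\int[P]_w (I h w ^+ 2)%:E = c%:E * norm2 h)%E.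
Proof.
move=> [symh mh sqh degh].
exact: (integral_directing_sqr theta_gt0 XDQ Q_perm Q_rcons mh symh sqh degh).
Qed.

Let c_gt0 : 0 < c. Proof. exact: overlap_coef_gt0. Qed.

Let law : giry (m.+1.-tuple T) R := giry_map mx_ P.

Let dist2_law (f g : m.+1.-tuple T -> R) : measurable_fun setT f -> measurable_fun setT g ->
  (\int[law]_t ((f t - g t) ^+ 2)%:E = norm2 (fun t => f t - g t)%R)%E.
Proof.
move=> mf mg.
apply: (ge0_integral_pushforward mx_ P measurableT (f := fun t => ((f t - g t) ^+ 2)%:E)).
  exact/measurable_EFinP/measurable_funX/measurable_funB.
by move=> t _; rewrite lee_fin sqr_ge0.
Qed.

Let norm2_isometryE h : degenerate h ->
  (norm2 h = (c^-1)%:E * \int[P]_w (I h w ^+ 2)%:E)%E.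
Proof.
move=> dh; rewrite directing_integral_isometry// muleA -EFinM mulVf ?mul1e//.
by rewrite gt_eqF.
Qed.

Let dist2_directing h g : degenerate h -> degenerate g ->
  (\int[P]_w (I (fun t => h t - g t)%R w ^+ 2)%:E = \int[P]_w ((I h w - I g w) ^+ 2)%:E)%E.
Proof.
move=> dh dg; have [mh' _] := sqI dh; have [mg' _] := sqI dg.
have [mhg _] := sqI (degenerateB dh dg).
apply: ae_eq_integral => //.
- exact/measurable_EFinP/measurable_funX.
- exact/measurable_EFinP/measurable_funX/measurable_funB.
by apply: filterS (directing_integral_B dh dg) => w -> _.
Qed.

(** Integrals over a fixed event are continuous for the L2 distance, so degeneracy passes to the
    limit. Symmetry is assumed for [g], because an L2 limit is determined only up to null sets. *)
Let degenerate_limit (hn : nat -> m.+1.-tuple T -> R) g (phi : nat -> nat) :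
  (forall n, degenerate (hn n)) -> measurable_fun setT g ->
  (forall (s : 'S_m.+1) t, g [tuple tnth t (s i) | i < m.+1] = g t) ->
  (forall k, (norm2 (fun t => hn (phi k) t - g t)%R <= ((2 ^ k * 2 ^ k.+1)%:R^-1)%:E)%E) ->
  degenerate g.
Proof.
move=> dhn mg symg hg.
have sqB k : sq_integrable P ((fun t => hn (phi k) t - g t) \o x_).
  split; last by rewrite (le_lt_trans (hg k))// ltry.
  by apply: (measurableT_comp _ mx_); apply: measurable_funB => //; have [] := dhn (phi k).
have sqg : sq_integrable P (g \o x_).
  have [_ _ sq0 _] := dhn (phi 0%N).
  have := sq_integrableB sq0 (sqB 0%N); congr sq_integrable.
  by apply/funext => w /=; rewrite opprB addrC subrK.
split=> // S mS; have mpS := past_measurable mS.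
set pS := _ @^-1` S in mpS *.
have ig := integrable_on sqg mS.
rewrite -(fineK (integrable_fin_num mpS ig)).
set q := fine _.
have q_le k : `|q| <= 2 * 2^-1 ^+ k.
  pose dlt : R := 2^-1 ^+ k.
  have d0 : 0 < dlt by rewrite exprn_gt0// invr_gt0.
  have [_ mhk sqhk deghk] := dhn (phi k).
  have ihk := integrable_on sqhk mS.
  have iB := integrableS measurableT mpS (@subsetT _ _) (sq_integrable_integrable (sqB k)).
  pose x w := hn (phi k) (x_ w) - g (x_ w).
  have mx : measurable_fun setT x by have [] := sqB k.
  have mabs : measurable_fun setT (fun w => `|(x w)%:E|%E).
    by apply: measurableT_comp => //; exact/measurable_EFinP.
  have msq : measurable_fun setT (fun w => (x w ^+ 2)%:E).
    exact/measurable_EFinP/measurable_funX.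
  have -> : `|q| = `|- q| by rewrite normrN.
  rewrite -lee_fin.
  have -> : (`|- q|%:E = `|\int[P]_(w in pS) (x w)%:E|)%E.
    rewrite integralB_EFin// (deghk S mS) -(fineK (integrable_fin_num mpS ig)).
    by rewrite sub0e.
  have mxS : measurable_fun pS (fun w => (x w)%:E).
    by apply: measurable_funTS; exact/measurable_EFinP.
  apply: le_trans (le_abse_integral _ mpS mxS) _.
  apply: (@le_trans _ _ (\int[P]_w `|(x w)%:E|)%E).
    by apply: ge0_subset_integral => //; exact: abse_ge0.
  (* In place of Cauchy-Schwarz, [y] is bounded by [dlt + dlt^-1 * y ^+ 2]. With [dlt] equal to 2^-k
     and a squared distance of at most 2^-(2k+1), both terms are at most 2^-k. *)
  apply: (@le_trans _ _ (\int[P]_w (dlt%:E + dlt^-1%:E * (x w ^+ 2)%:E))%E).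
    apply: ge0_le_integral => //.
      by apply: emeasurable_funD => //; exact: measurable_funeM.
    move=> w _; rewrite -EFinM -EFinD lee_fin -(real_normK (num_real (x w))).
    set y := `|x w|; have y0 : 0 <= y by exact: normr_ge0.
    rewrite -subr_ge0.
    have -> : dlt + dlt^-1 * y ^+ 2 - y = ((y - dlt) ^+ 2 + y * dlt) / dlt.
      by field; rewrite gt_eqF.
    by apply: divr_ge0; [rewrite addr_ge0 ?sqr_ge0 ?mulr_ge0// ltW|exact: ltW].
  rewrite ge0_integralD//; last 3 first.
  - by move=> w _; rewrite lee_fin ltW.
  - by move=> w _; rewrite -EFinM lee_fin mulr_ge0 ?sqr_ge0// invr_ge0 ltW.
  - exact: measurable_funeM.
  rewrite integral_cst// [X in (_ * X)%E](@probability_setT _ _ _ P) mule1.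
  rewrite ge0_integralZl//; last 2 first.
  - by move=> w _; rewrite lee_fin sqr_ge0.
  - by rewrite lee_fin invr_ge0 ltW.
  apply: (@le_trans _ _ (dlt%:E + dlt^-1%:E * ((2 ^ k * 2 ^ k.+1)%:R^-1)%:E)%E).
    by apply: leeD2l; apply: lee_wpmul2l; [rewrite lee_fin invr_ge0 ltW|exact: hg].
  rewrite -EFinM -EFinD lee_fin mulr_natl mulr2n lerD2l.
  rewrite /dlt exprVn invrK natrM !natrX invfM mulrA divff ?mul1r; last first.
    by rewrite expf_neq0.
  by rewrite lef_pV2 ?posrE ?exprn_gt0// ler_eXn2l// ?ltr1n.
suff -> : q = 0 by [].
apply/normr0_eq0/eqP; rewrite eq_le normr_ge0 andbT.
have h0 : (fun k => 2 * 2^-1 ^+ k : R) @ \oo --> 0.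
  rewrite -(mulr0 2); apply: cvgMr; apply: cvg_expr.
  by rewrite ger0_norm// invf_lt1// ltr1n.
exact: (cvgr_to_ge h0 (nearW _ q_le)).
Qed.

(** Convergence of the integrals makes them Cauchy, and since [c] is positive the isometry makes the
    kernels Cauchy for the law of the first [m.+1] variables. Applied to the limit kernel, the
    isometry then identifies the limit of the integrals. *)
Lemma degenerate_closed (hn : nat -> m.+1.-tuple T -> R) (Y : Omega -> R) :
  (forall n, degenerate (hn n)) -> measurable_fun setT Y ->
  (fun n => \int[P]_w ((I (hn n) w - Y w) ^+ 2)%:E)%E @ \oo --> 0%E ->
  exists2 g, degenerate g & {ae P, forall w, Y w = I g w}.
Proof.
move=> dhn mY cvgY.
pose e n := (\int[P]_w ((I (hn n) w - Y w) ^+ 2)%:E)%E.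
have mI n : measurable_fun setT (I (hn n)) by have [] := sqI (dhn n).
have e_le (r : R) : 0 < r -> exists n0 : nat, forall n : nat, (n0 <= n)%N -> (e n <= r%:E)%E.
  move=> r0; have /fine_cvgP[efin /cvgrPdist_le/(_ _ r0) e0] := cvgY.
  have [n0 _ n0P] := filterI efin e0; exists n0 => n /n0P [/= fn].
  rewrite sub0r normrN => ern; rewrite -[e n](fineK fn) lee_fin.
  exact: le_trans (ler_norm _) ern.
have mhn n : measurable_fun setT (hn n) by have [] := dhn n.
have [phi [mg kphi hg]] : exists phi : nat -> nat,
    let g t := fine (limn_esup (fun k => (hn (phi k) t)%:E)) in
    [/\ measurable_fun setT g, forall k, (k <= phi k)%N &
      forall k, (\int[law]_t ((hn (phi k) t - g t) ^+ 2)%:E <= ((2 ^ k * 2 ^ k.+1)%:R^-1)%:E)%E].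
  apply: L2_complete => // r r0.
  (* Both integrals will be within [c * r / 4] of [Y]; doubled by [integral_sqrB] and divided by
     [c], the two errors add up to [r]. *)
  have cr0 : 0 < c * r / 4 by rewrite divr_gt0// mulr_gt0.
  have [n0 n0P] := e_le _ cr0; exists n0 => i j n0i n0j.
  rewrite dist2_law// norm2_isometryE; last exact: degenerateB.
  rewrite dist2_directing//.
  apply: le_trans (lee_wpmul2l _ (integral_sqrB P (mI i) (mI j) mY)) _.
    by rewrite lee_fin invr_ge0 ltW.
  apply: (@le_trans _ _ (c^-1%:E * (2%:E * (c * r / 4)%:E + 2%:E * (c * r / 4)%:E))%E).
    apply: lee_wpmul2l; first by rewrite lee_fin invr_ge0 ltW.
    by apply: leeD; apply: lee_wpmul2l => //; exact: n0P.
  rewrite -(EFinM 2) -EFinD -EFinM lee_fin le_eqVlt; apply/orP; left; apply/eqP.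
  by field; rewrite gt_eqF.
set g := fun t => fine _ in mg hg.
have {}hg k : (norm2 (fun t => hn (phi k) t - g t)%R <= ((2 ^ k * 2 ^ k.+1)%:R^-1)%:E)%E.
  by rewrite -dist2_law//; exact: hg.
have dg : degenerate g.
  apply: (degenerate_limit dhn mg _ hg) => s t; congr fine; congr limn_esup.
  by apply/funext => k; have [-> _ _ _] := dhn (phi k).
exists g => //.
have [mIg _] := sqI dg.
suff /(sq_integral_eq0 (measurable_funB mY mIg)) : (\int[P]_w ((Y w - I g w) ^+ 2)%:E = 0)%E.
  by apply: filterS => w /eqP; rewrite subr_eq0 => /eqP.
have bound k : (\int[P]_w ((Y w - I g w) ^+ 2)%:E <=
    2%:E * e (phi k) + 2%:E * (c * 2^-1 ^+ k)%:E)%E.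
  apply: le_trans (integral_sqrB P mY mIg (mI (phi k))) _.
  apply: leeD.
    apply: lee_wpmul2l => //; rewrite le_eqVlt; apply/orP; left; apply/eqP.
    by apply: eq_integral => w _; rewrite -sqrrN opprB.
  apply: lee_wpmul2l => //.
  apply: (@le_trans _ _ (\int[P]_w ((I (hn (phi k)) w - I g w) ^+ 2)%:E)%E).
    rewrite le_eqVlt; apply/orP; left; apply/eqP.
    by apply: eq_integral => w _; rewrite -sqrrN opprB.
  rewrite -dist2_directing// directing_integral_isometry; last exact: degenerateB.
  rewrite [leRHS]EFinM; apply: lee_wpmul2l; first by rewrite lee_fin ltW.
  apply: le_trans (hg k) _.
  rewrite lee_fin exprVn -natrX lef_pV2 ?posrE ?ltr0n ?muln_gt0 ?expn_gt0//.
  by rewrite ler_nat leq_pmulr// expn_gt0.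
apply/eqP; rewrite eq_le; apply/andP; split; last first.
  by apply: integral_ge0 => w _; rewrite lee_fin sqr_ge0.
apply/lee_addgt0Pr => r r0; rewrite add0e.
have [n0 n0P] := e_le (r / 4) (divr_gt0 r0 (ltr0n _ 4)).
have h0 : (fun k => c * 2^-1 ^+ k : R) @ \oo --> 0.
  rewrite -(mulr0 c); apply: cvgMr; apply: cvg_expr.
  by rewrite ger0_norm// invf_lt1// ltr1n.
have /cvgrPdist_le/(_ _ (divr_gt0 r0 (ltr0n _ 4)))[n1 _ n1P] := h0.
pose k := maxn n0 n1.
apply: le_trans (bound k) _.
apply: (@le_trans _ _ (2%:E * (r / 4)%:E + 2%:E * (r / 4)%:E)%E).
  apply: leeD; apply: lee_wpmul2l => //.
    by apply: n0P; exact: leq_trans (leq_maxl n0 n1) (kphi k).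
  have /= := n1P k (leq_maxr n0 n1); rewrite sub0r normrN lee_fin.
  exact: le_trans (ler_norm _).
rewrite -(EFinM 2) -EFinD lee_fin le_eqVlt; apply/orP; left; apply/eqP.
by field.
Qed.

End degenerate_space.

(** * Application to the Polya sequence *)

Section polya_directing.
Context (R : realType) (A : ptopologicalType).
Variable alpha : {finite_measure set (borel A) -> \bar R}.
Context d (Omega : measurableType d) (P : probability Omega R).
Variable X : nat -> {RV P >-> borel A}.
Hypothesis polyaX : polya_sequence alpha X.

Lemma polya_sorted (s : seq (nat * set (borel A))) : sorted ltn (map fst s) ->
  (forall p, p \in s -> measurable p.2) ->
  (\int[P]_w (\prod_(p <- s) \1_(p.2) (X p.1 w))%:E = polya_law alpha [::] (map snd s))%E.
Proof.
case: s => [_ _|p0 s'].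
  (* The definition of a Polya sequence starts at [k = 1], so the empty product is treated apart. *)
  under eq_integral do rewrite big_nil.
  by rewrite integral_cst// [X in (_ * X)%E](@probability_setT _ _ _ P) mule1.
set s := p0 :: s' => sorts ms.
pose B (i : 'I_(size s)) := (nth p0 s i).2.
pose j (i : 'I_(size s)) := (nth p0 s i).1.
have mB i : measurable (B i) by apply: ms; exact: mem_nth (ltn_ord i).
have jE i : j i = nth 0%N (map fst s) i by rewrite (nth_map p0).
have homoj : {homo j : i l / (i < l)%N}.
  move=> i l il; rewrite !jE.
  apply: (sorted_ltn_nth ltn_trans) => //; rewrite inE size_map; exact: ltn_ord.
have -> : map snd s = [seq B i | i <- enum 'I_(size s)].
  rewrite -[X in map snd X](mkseq_nth p0) /mkseq -val_enum_ord -!map_comp.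
  exact: eq_map.
rewrite -(polyaX (k := size s) isT homoj mB).
set E := \bigcap_(i in _) _.
have mE : measurable E.
  apply: fin_bigcap_measurable => // i _.
  by rewrite -[X in measurable X]setTI; exact: measurable_funP.
transitivity (\int[P]_w (\1_E w)%:E)%E; last by rewrite integral_indic// setIT.
apply: eq_integral => w _; congr EFin; rewrite (big_nth p0) big_mkord.
have [Ew|/existsNP[i /not_implyP[_ nB]]] := pselect (E w).
  rewrite [RHS]indicE mem_set// big1// => i _.
  by rewrite indicE mem_set//; exact: (Ew i I).
rewrite (bigD1 i)//= [X in X * _]indicE memNset// mul0r indicE memNset// => Ew.
exact: nB (Ew i I).
Qed.

Hypothesis alpha_gt0 : (0 < alpha setT)%E.

Lemma polya_law_rcons_nil (Bs : seq (set (borel A))) (C : set (borel A)) :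
  (forall B, B \in Bs -> measurable B) -> measurable C ->
  ((fine (alpha setT) + (size Bs)%:R)%:E * polya_law alpha [::] (rcons Bs C) =
   alpha C * polya_law alpha [::] Bs +
   \sum_(l < size Bs) polya_law alpha [::] (set_nth setT Bs l (nth setT Bs l `&` C)))%E.
Proof.
move=> mBs mC; have := polya_law_rcons alpha_gt0 [::] mBs mC.
by rewrite add0n polya_urnE big_ord0 adde0.
Qed.

End polya_directing.

Section directing_sigma_algebra.
Context (R : realType) (A : ptopologicalType).
Context d (Omega : measurableType d) (P : probability Omega R).
Variable D : {RV P >-> pprobability (borel A) R}.

Let G := \bigcup_(C in measurable)
  sigma_of (fun w => (D w : probability (borel A) R) C).
(** The same set as [Omega], carrying only the sigma-algebra generated by [D]: measurability for
    [sigma_D] becomes an ordinary [measurable_fun]. *)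
Let Omega_D := g_sigma_algebraType G.

Lemma sigma_D_measurable (Y : Omega -> R) :
  (forall B : set R, measurable B -> sigma_D D (Y @^-1` B)) <->
  measurable_fun setT (Y : Omega_D -> R).
Proof.
split=> [mY _ B mB|mY B mB]; first by rewrite setTI; exact: mY.
by have := mY measurableT B mB; rewrite setTI.
Qed.

Lemma sub_sigma_D S : sigma_D D S -> measurable S.
Proof.
apply: smallest_sub; first exact: sigma_algebra_measurable.
move=> E [C mC [B mB <-]]; exact: (measurable_directing D mC).
Qed.

Lemma L2_DE (Y : Omega -> R) : L2_D D Y <->
  measurable_fun setT (Y : Omega_D -> R) /\ sq_integrable P Y.
Proof.
rewrite /L2_D /= sigma_D_measurable unlock; split=> [[mY Y2]|[mY [_ Y2]]]; split => //.
split=> // _ B mB; rewrite setTI.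
by apply: sub_sigma_D; move/sigma_D_measurable: mY; apply.
Qed.

(** This version of the integral is a function of [D w] alone, hence measurable for the
    sigma-algebra of [D] exactly and not just up to a null set, as [L2_D] demands. *)
Lemma directing_integral_sigma_D n (h : n.-tuple (borel A) -> R) :
  measurable_fun setT h ->
  measurable_fun setT (directing_integral D h : Omega_D -> R).
Proof.
move=> mh; apply: (measurable_fine_integral_giry (S := Omega_D)) => //.
apply: (measurable_tuple_power (S := Omega_D)) => C mC _ B mB.
by rewrite setTI; apply: sub_sigma_algebra; exists C => //; exists B => //; rewrite setTI.
Qed.

End directing_sigma_algebra.

Section degenerate_kernels.
Context (R : realType) (A : ptopologicalType).
Context d (Omega : measurableType d) (P : probability Omega R).
Variable X : nat -> {RV P >-> borel A}.

Lemma prefix_vectorE n : prefix_vector X n = subvector X n (iota 0 n).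
Proof.
apply/funext => w; apply: eq_from_tnth => i.
by rewrite !tnth_mktuple nth_iota.
Qed.

Lemma Xi_degenerate m (h : m.+1.-tuple (borel A) -> R) : Xi X h <-> degenerate X h.
Proof.
rewrite /Xi /degenerate /is_cond_expectation /sigma_of /= unlock !prefix_vectorE.
have mx := measurable_subvector X (n := m.+1) (iota 0 m.+1).
split=> [[symh mh sqh [_ _ _ ceh]]|[symh mh sqh degh]].
  split=> //; first by split => //; exact: measurableT_comp mx.
  move=> S mS; rewrite ceh ?integral0//.
  by exists S => //; rewrite setTI.
split=> //; first by case: sqh.
split.
- exact: sq_integrable_integrable.
- exact: (finite_measure_integrable_cst P 0 measurableT).
- move=> B mB; rewrite preimage_cst; case: ifPn => _.
    by exists setT => //; rewrite setTI preimage_setT.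
  by exists set0 => //; rewrite setTI preimage_set0.
- by move=> E [S mS <-]; rewrite setTI degh// integral0.
Qed.

End degenerate_kernels.

Section closed_span.
Context (R : realType) (A : ptopologicalType).
Variable alpha : {finite_measure set (borel A) -> \bar R}.
Hypothesis alpha_gt0 : (0 < alpha setT)%E.
Context d (Omega : measurableType d) (P : probability Omega R).
Variables (X : nat -> {RV P >-> borel A}) (D : {RV P >-> pprobability (borel A) R}).
Hypothesis polyaX : polya_sequence alpha X.
Hypothesis limitD : empirical_limit X D.
Variable m : nat.
Implicit Types (h : m.+1.-tuple (borel A) -> R) (Y : Omega -> R).

Let th0 := theta_gt0 alpha_gt0.
Let XDQ := directing_uniq (polya_sorted polyaX) limitD.
Let Q_perm := directing_perm (polya_sorted polyaX) limitD.
Let Q_rcons := polya_law_rcons_nil alpha_gt0.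

Local Notation I := (directing_integral D).

Let mh h (dh : degenerate X h) : measurable_fun setT h.
Proof. by case: dh. Qed.

Let sqh h (dh : degenerate X h) :
  sq_integrable P (h \o subvector X m.+1 (iota 0 m.+1)).
Proof. by case: dh. Qed.

Let sqI h (dh : degenerate X h) : sq_integrable P (I h) :=
  sq_integrable_directing XDQ (mh dh) (sqh dh).

Lemma L2_D_directing h : degenerate X h -> L2_D D (I h).
Proof.
move=> dh; apply/L2_DE; split; last exact: (sqI dh).
exact: directing_integral_sigma_D (mh dh).
Qed.

Lemma L2_cvg_ustat h : degenerate X h -> L2_cvg P (U_statistic X h) (I h).
Proof.
move=> dh; rewrite /L2_cvg unlock.
exact: (ustat_cvg XDQ (ltn0Sn m) (mh dh) (sqh dh)).
Qed.

Let eq_sqr_dist (u Y Z : Omega -> R) : measurable_fun setT u -> measurable_fun setT Y ->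
  measurable_fun setT Z -> {ae P, forall w, Y w = Z w} ->
  (\int[P]_w ((u w - Y w) ^+ 2)%:E = \int[P]_w ((u w - Z w) ^+ 2)%:E)%E.
Proof.
move=> mu mY mZ YZ; apply: ae_eq_integral => //.
- exact/measurable_EFinP/measurable_funX/measurable_funB.
- exact/measurable_EFinP/measurable_funX/measurable_funB.
by apply: filterS YZ => w -> _.
Qed.

(** The integral is almost surely finite, so the equation between extended reals in [M_D] can be
    replaced by one between reals. *)
Lemma M_DE Y : M_D X D m.+1 Y <->
  L2_D D Y /\ exists2 h : m.+1.-tuple (borel A) -> R,
    degenerate X h & {ae P, forall w, Y w = I h w}.
Proof.
split=> -[LY [h hh Yh]]; split => //; exists h; try exact/Xi_degenerate.
  have dh : degenerate X h by exact/Xi_degenerate.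
  apply: filterS2 Yh (ae_directing_integralE XDQ (mh dh) (sqh dh)) => w Yw Iw.
  by apply: EFin_inj; rewrite Yw Iw.
apply: filterS2 Yh (ae_directing_integralE XDQ (mh hh) (sqh hh)) => w -> ->.
by [].
Qed.

(** [I h] is an L2 limit of the U-statistics of [h], and such a limit is unique up to a null set.
    Both sides consist of elements of [L2_D] and are insensitive to null sets, so they agree kernel
    by kernel. *)
Lemma M_D_U_limits : M_D X D m.+1 = U_limits X D m.+1.
Proof.
apply/seteqP; split => Y.
  move=> /M_DE[LY [h dh Yh]]; split => //; exists h; first exact/Xi_degenerate.
  have := L2_cvg_ustat dh; rewrite /L2_cvg unlock.
  have [_ [mY _]] := (L2_DE _ _).1 LY.
  move=> /(cvg_trans _); apply; apply: near_eq_cvg; apply: nearW => K.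
  apply: eq_sqr_dist => //.
  - by have [] := ustat_integrable XDQ (mh dh) (sqh dh) K.
  - by have [] := sqI dh.
  - by apply: filterS Yh => w ->.
move=> [LY [h /Xi_degenerate dh UY]]; apply/M_DE; split => //; exists h => //.
have [_ [mY _]] := (L2_DE _ _).1 LY.
have := L2_cvg_ustat dh; move: UY; rewrite /L2_cvg unlock.
apply: sq_integral_cvg_unique => //.
- by move=> K; have [] := ustat_integrable XDQ (mh dh) (sqh dh) K.
- by have [] := sqI dh.
Qed.

Lemma M_D_closed : closed_subspace_L2_D D (M_D X D m.+1).
Proof.
split.
- by move=> Y [].
- apply/M_DE; split.
    apply/L2_DE; split; first exact: measurable_cst.
    exact: sq_integrable_cst.
  exists (cst 0); first exact: degenerate0.
  by apply/aeW => w; rewrite /directing_integral integral0.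
- move=> a Y Z /M_DE[/L2_DE[sY LY] [h dh Yh]] /M_DE[/L2_DE[sZ LZ] [g dg Zg]].
  apply/M_DE; split.
    apply/L2_DE; split; first by apply: measurable_funD => //; exact: measurable_funM.
    exact: (sq_integrableD (sq_integrableZ a LY) LZ).
  exists (fun t => a * h t + g t); first exact: degenerate_linear.
  have := directing_integral_linear XDQ a dh dg.
  by apply: filterS3 Yh Zg => w -> -> ->.
move=> u Y Mu LY uY; apply/M_DE; split => //.
have /choice[hn hnP] n :
    exists h : m.+1.-tuple (borel A) -> R, degenerate X h /\ {ae P, forall w, u n w = I h w}.
  by have /M_DE[_ [h dh uh]] := Mu n; exists h.
have [_ [mY _]] := (L2_DE _ _).1 LY.
apply: (degenerate_closed th0 XDQ Q_perm Q_rcons (hn := hn)) => //.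
  by move=> n; case: (hnP n).
move: uY; rewrite /L2_cvg unlock => /(cvg_trans _); apply.
apply: near_eq_cvg; apply: nearW => n.
have [dh uh] := hnP n; have /M_DE[/L2_DE[_ [mu _]] _] := Mu n.
apply: ae_eq_integral => //.
- exact/measurable_EFinP/measurable_funX/measurable_funB.
- apply/measurable_EFinP/measurable_funX/measurable_funB => //.
  by have [] := sqI dh.
by apply: filterS uh => w -> _.
Qed.

End closed_span.

Theorem corollary2 (R : realType) (A : ptopologicalType)
  (polishA : polish R A)
  (alpha : {finite_measure set (borel A) -> \bar R})
  (alpha_gt0 : (0 < alpha setT)%E)
  (d : measure_display) (Omega : measurableType d) (P : probability Omega R)
  (X : nat -> {RV P >-> borel A})
  (D : {RV P >-> pprobability (borel A) R})
  (polyaX : polya_sequence alpha X)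
  (dirichletD : dirichlet_ferguson alpha D)
  (limitD : empirical_limit X D)
  (N : nat) (N_ge1 : (1 <= N)%N) :
  (forall h, Xi X h -> exists2 Y, L2_D D Y & L2_cvg P (U_statistic X (n := N) h) Y) /\
  M_D X D N = smallest (closed_subspace_L2_D D) (U_limits X D N).
Proof.
case: N N_ge1 => [//|m] _; split.
  move=> h /Xi_degenerate dh; exists (directing_integral D h).
    exact: (L2_D_directing polyaX limitD dh).
  exact: (L2_cvg_ustat polyaX limitD dh).
(* The set of limits is already a closed subspace, hence equal to its closed span. *)
rewrite -(M_D_U_limits polyaX limitD) smallest_id//.
exact: (M_D_closed alpha_gt0 polyaX limitD).
Qed.
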